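(* Let $G\subset \mathrm{PSL}(2,\mathbb{R})$ be a non uniform lattice and assume that $\infty$ is a cusp of $G$. Then the Lagrange spectrum $\mathcal{L}(G,\infty)$ contains a Hall ray, i.e. there exists $L_0=L_0(G,\infty)\in\mathbb{R}$ such that $$[L_0,+\infty]\subset\mathcal{L}(G,\infty).$$
   Context: $\mathrm{PSL}(2,\mathbb{R})$ acts by Möbius transformations on the upper half-plane $\mathbb{H}$ and on its boundary $\overline{\mathbb{R}}=\mathbb{R}\cup\{\infty\}$. A non uniform lattice is a discrete subgroup $G\subset\mathrm{PSL}(2,\mathbb{R})$ such that $G\backslash\mathbb{H}$ has finite hyperbolic area but is not compact. A cusp of $G$ is a point of $\overline{\mathbb{R}}$ fixed by a non-trivial parabolic element of $G$. For $g\in G$ let $a(g)$ and $c(g)$ be the first entries of the first and of the second row of a matrix representing $g$ (so $c(g)^2$ and $a(g)/c(g)=g\cdot\infty$ are well defined). For $\alpha\in\mathbb{R}$ define $L_G(\alpha)\in[0,+\infty]$ to be the supremum of the $k>0$ such that $$\left|\alpha-g\cdot\infty\right|=\left|\alpha-\frac{a(g)}{c(g)}\right|<\frac{1}{k\,c(g)^2}$$ holds for infinitely many $g\in G$ whose images $g\cdot\infty$ are all distinct (the supremum being taken in $[0,+\infty]$). The Lagrange spectrum of $G$ with respect to $\infty$ is $\mathcal{L}(G,\infty):=\{L_G(\alpha):\alpha\in\mathbb{R}\}\subset[0,+\infty]$. *)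

(* Defs.v *)
From HB Require Import structures.
From mathcomp Require Import all_boot all_order all_algebra.
From mathcomp Require Import complex ring.
From mathcomp Require Import all_classical all_reals all_analysis.

Set Implicit Arguments.
Unset Strict Implicit.
Unset Printing Implicit Defensive.

Import Order.TTheory GRing.Theory Num.Theory.
Import numFieldNormedType.Exports.

Local Open Scope classical_set_scope.
Local Open Scope ring_scope.
Local Open Scope quotient_scope.

Record SL2 (R : realType) := MkSL2 {
  SL2mx :> 'M[R]_2 ;
  SL2mx_det : \det SL2mx == 1 }.

HB.instance Definition _ (R : realType) := [isSub for @SL2mx R].
HB.instance Definition _ (R : realType) := [Choice of SL2 R by <:].
HB.instance Definition _ (R : realType) :=
  Topological.copy (SL2 R) (initial_topology (@SL2mx R)).

Section SL2Group.
Context {R : realType}.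
Implicit Types A B C : SL2 R.

Lemma det_SL2 A : \det A = 1.
Proof. exact/eqP/SL2mx_det. Qed.

Lemma SL2_unitmx A : SL2mx A \in unitmx.
Proof. by rewrite unitmxE det_SL2 unitr1. Qed.

Fact SL2_one_subproof : \det (1%:M : 'M[R]_2) == 1.
Proof. by rewrite det1. Qed.

Fact SL2_mul_subproof A B : \det (A *m B) == 1.
Proof. by rewrite det_mulmx !det_SL2 mulr1. Qed.

Fact SL2_inv_subproof A : \det (invmx A) == 1.
Proof. by rewrite det_inv det_SL2 invr1. Qed.

Fact SL2_opp_subproof A : \det (- SL2mx A) == 1.
Proof. by rewrite -scaleN1r detZ sqrrN expr1n mul1r det_SL2. Qed.

Definition SL2_one := MkSL2 SL2_one_subproof.
Definition SL2_mul A B := MkSL2 (SL2_mul_subproof A B).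
Definition SL2_inv A := MkSL2 (SL2_inv_subproof A).
Definition SL2_opp A := MkSL2 (SL2_opp_subproof A).

Fact SL2_mulA : associative SL2_mul.
Proof. by move=> A B C; apply/val_inj; rewrite /= mulmxA. Qed.
Fact SL2_mul1g : left_id SL2_one SL2_mul.
Proof. by move=> A; apply/val_inj; rewrite /= mul1mx. Qed.
Fact SL2_mulg1 : right_id SL2_one SL2_mul.
Proof. by move=> A; apply/val_inj; rewrite /= mulmx1. Qed.
Fact SL2_mulVg : left_inverse SL2_one SL2_inv SL2_mul.
Proof. by move=> A; apply/val_inj; rewrite /= mulVmx ?SL2_unitmx. Qed.
Fact SL2_mulgV : right_inverse SL2_one SL2_inv SL2_mul.
Proof. by move=> A; apply/val_inj; rewrite /= mulmxV ?SL2_unitmx. Qed.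

HB.instance Definition _ := isGroup.Build (SL2 R)
  SL2_mulA SL2_mul1g SL2_mulg1 SL2_mulVg SL2_mulgV.

End SL2Group.

Section PSL2.
Context {R : realType}.
Implicit Types A B C : SL2 R.

Definition eq_up_to_sign A B := (A == B) || (A == SL2_opp B).

Lemma SL2_oppK : involutive (@SL2_opp R).
Proof. by move=> A; apply/val_inj; rewrite /= opprK. Qed.

Fact eq_up_to_sign_refl : reflexive eq_up_to_sign.
Proof. by move=> A; rewrite /eq_up_to_sign eqxx. Qed.

Fact eq_up_to_sign_sym : symmetric eq_up_to_sign.
Proof.
by move=> A B; rewrite /eq_up_to_sign -(inv_eq SL2_oppK) !(eq_sym B).
Qed.

Fact eq_up_to_sign_trans : transitive eq_up_to_sign.
Proof.
move=> B A C /orP[]/eqP-> /orP[]/eqP->; rewrite /eq_up_to_sign ?eqxx ?orbT //.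
by rewrite SL2_oppK eqxx.
Qed.

Canonical eq_up_to_sign_equiv := EquivRel eq_up_to_sign
  eq_up_to_sign_refl eq_up_to_sign_sym eq_up_to_sign_trans.

End PSL2.

Definition PSL2 (R : realType) : Type :=
  quotient_topology {eq_quot (@eq_up_to_sign_equiv R)}.

HB.instance Definition _ (R : realType) := Quotient.on (PSL2 R).
HB.instance Definition _ (R : realType) := Topological.on (PSL2 R).

Section PSL2Group.
Context {R : realType}.
Implicit Types (A B : SL2 R) (g h k : PSL2 R).

Lemma PSL2_piP A B : \pi_(PSL2 R) A = \pi_(PSL2 R) B <-> eq_up_to_sign A B.
Proof.
have h := @eqmodP _ (@eq_up_to_sign_equiv R) A B.
by split => [e|e]; apply/h.
Qed.

Definition PSL2_one : PSL2 R := \pi_(PSL2 R) 1%g.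
Definition PSL2_mul g h : PSL2 R := \pi_(PSL2 R) (repr g * repr h)%g.
Definition PSL2_inv g : PSL2 R := \pi_(PSL2 R) ((repr g)^-1)%g.

Lemma repr_PSL2_pi A :
  repr (\pi_(PSL2 R) A) = A \/ repr (\pi_(PSL2 R) A) = SL2_opp A.
Proof.
have /PSL2_piP : \pi_(PSL2 R) (repr (\pi_(PSL2 R) A)) = \pi_(PSL2 R) A.
  exact: reprK.
by case/orP => /eqP; [left|right].
Qed.

Lemma PSL2_mul_pi A B :
  PSL2_mul (\pi_(PSL2 R) A) (\pi_(PSL2 R) B) = \pi_(PSL2 R) (A * B)%g.
Proof.
apply/PSL2_piP/orP.
case: (repr_PSL2_pi A) (repr_PSL2_pi B) => -> [] ->; rewrite ?eqxx; auto;
  [right|right|left]; apply/eqP/val_inj; by rewrite /= ?mulNmx ?mulmxN ?opprK.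
Qed.

Lemma PSL2_inv_pi A : PSL2_inv (\pi_(PSL2 R) A) = \pi_(PSL2 R) (A^-1)%g.
Proof.
apply/PSL2_piP/orP; case: (repr_PSL2_pi A) => ->; [left|right]; rewrite //.
apply/eqP/val_inj => /=; apply: (@row_free_inj _ _ _ _ (SL2mx A)).
  by rewrite row_free_unit SL2_unitmx.
rewrite mulNmx mulVmx ?SL2_unitmx //.
by rewrite -[LHS]opprK -mulmxN mulVmx // (SL2_unitmx (SL2_opp A)).
Qed.

Fact PSL2_mulA : associative PSL2_mul.
Proof.
elim/quotW=> A; elim/quotW=> B; elim/quotW=> C.
by rewrite (PSL2_mul_pi B C) (PSL2_mul_pi A B) !PSL2_mul_pi mulgA.
Qed.
Fact PSL2_mul1g : left_id PSL2_one PSL2_mul.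
Proof. by elim/quotW=> A; rewrite (PSL2_mul_pi 1%g A) mul1g. Qed.
Fact PSL2_mulg1 : right_id PSL2_one PSL2_mul.
Proof. by elim/quotW=> A; rewrite (PSL2_mul_pi A 1%g) mulg1. Qed.
Fact PSL2_mulVg : left_inverse PSL2_one PSL2_inv PSL2_mul.
Proof.
by elim/quotW=> A; rewrite (PSL2_inv_pi A) (PSL2_mul_pi A^-1%g A) mulVg.
Qed.
Fact PSL2_mulgV : right_inverse PSL2_one PSL2_inv PSL2_mul.
Proof.
by elim/quotW=> A; rewrite (PSL2_inv_pi A) (PSL2_mul_pi A A^-1%g) mulgV.
Qed.

HB.instance Definition _ := isGroup.Build (PSL2 R)
  PSL2_mulA PSL2_mul1g PSL2_mulg1 PSL2_mulVg PSL2_mulgV.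

(* The entries of a matrix representing g; they are defined up to a common
   sign. *)
Definition ent_a g : R := SL2mx (repr g) 0 0.
Definition ent_b g : R := SL2mx (repr g) 0 1.
Definition ent_c g : R := SL2mx (repr g) 1 0.
Definition ent_d g : R := SL2mx (repr g) 1 1.

Lemma PSL2_det g : ent_a g * ent_d g - ent_b g * ent_c g = 1.
Proof.
rewrite -(det_SL2 (repr g)) (expand_det_row _ 0) !big_ord_recl big_ord0 addr0.
rewrite /cofactor !det_mx11 !mxE /= expr0 mul1r expr1 mulN1r mulrN.
by rewrite /ent_a /ent_b /ent_c /ent_d; congr (_ * _ - _ * _);
  congr (SL2mx _ _ _); apply/val_inj.
Qed.

End PSL2Group.

Record halfplane (R : realType) := MkHalfplane {
  hpt :> R[i] ;
  hpt_gt0 : 0 < complex.Im hpt }.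

HB.instance Definition _ (R : realType) := [isSub for @hpt R].
HB.instance Definition _ (R : realType) := [Choice of halfplane R by <:].

Definition hcoord {R : realType} (z : halfplane R) : R * R :=
  (complex.Re (hpt z), complex.Im (hpt z)).

HB.instance Definition _ (R : realType) :=
  Topological.copy (halfplane R) (initial_topology (@hcoord R)).

Section Moebius.
Context {R : realType}.
Local Open Scope complex_scope.
Implicit Types (g : PSL2 R) (z w : halfplane R) (G : set (PSL2 R)).

Definition moebius g (z : R[i]) : R[i] :=
  ((ent_a g)%:C * z + (ent_b g)%:C) / ((ent_c g)%:C * z + (ent_d g)%:C).

Fact moebius_halfplane g z : 0 < complex.Im (moebius g z).
Proof.
case: z => [[x y] /= y0]; rewrite /moebius; have := PSL2_det g.
move: (ent_a g) (ent_b g) (ent_c g) (ent_d g) => a b c d D.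
rewrite /= !(mul0r, add0r, addr0, subr0, mulr0).
set N := (_ ^+ 2 + _ ^+ 2); set P := a * x + b; set Q := c * x + d.
have N0 : 0 < N.
  rewrite /N lt_def addr_ge0 ?sqr_ge0 // andbT paddr_eq0 ?sqr_ge0 //.
  rewrite !sqrf_eq0; apply/negP => /andP[/eqP h1].
  rewrite mulf_eq0 (gt_eqF y0) orbF => /eqP h2.
  move: h1 D; rewrite /Q h2 mul0r add0r => ->.
  by rewrite !mulr0 subr0 => /eqP; rewrite eq_sym oner_eq0.
suff -> : P * - (c * y / N) + a * y * (Q / N) = y / N by rewrite divr_gt0.
rewrite -[y in RHS]mul1r -D /P /Q; ring.
Qed.

Definition hact g z : halfplane R := MkHalfplane (moebius_halfplane g z).

(* The boundary R u {oo}, with None for oo. *)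
Definition bact g (x : option R) : option R :=
  if x is Some t then
    if ent_c g * t + ent_d g == 0 then None
    else Some ((ent_a g * t + ent_b g) / (ent_c g * t + ent_d g))
  else if ent_c g == 0 then None else Some (ent_a g / ent_c g).

Definition orbit G z : set (halfplane R) := [set hact g z | g in G].

Definition same_orbit G : rel (halfplane R) :=
  [rel z w | `[< orbit G z = orbit G w >]].

Fact same_orbit_refl G : reflexive (same_orbit G).
Proof. by move=> z; apply/asboolP. Qed.
Fact same_orbit_sym G : symmetric (same_orbit G).
Proof. by move=> z w; apply/asboolP/asboolP. Qed.
Fact same_orbit_trans G : transitive (same_orbit G).
Proof. by move=> w z u /asboolP zw /asboolP wu; apply/asboolP; rewrite zw. Qed.

Canonical same_orbit_equiv G := EquivRel (same_orbit G)
  (same_orbit_refl G) (same_orbit_sym G) (@same_orbit_trans G).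

End Moebius.

Definition orbit_space (R : realType) (G : set (PSL2 R)) : Type :=
  quotient_topology {eq_quot (same_orbit_equiv G)}.

HB.instance Definition _ (R : realType) (G : set (PSL2 R)) :=
  Quotient.on (orbit_space G).
HB.instance Definition _ (R : realType) (G : set (PSL2 R)) :=
  Topological.on (orbit_space G).

Section Lattices.
Context {R : realType}.
Implicit Types (G : set (PSL2 R)) (F : set (halfplane R)).

Definition hyp_area F : \bar R :=
  (\int[lebesgue_measure \x lebesgue_measure]_(p in hcoord @` F)
    (p.2 ^- 2)%:E)%E.

(* A Borel set of representatives of the orbits.  When G is a discrete
   subgroup all of them have the same hyperbolic area, so that the infimum in
   [quotient_area] is their common value. *)
Definition fundamental_set G F :=
  measurable (hcoord @` F) /\
  set_bij F [set: orbit_space G] \pi_(orbit_space G).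

Definition quotient_area G : \bar R :=
  ereal_inf [set hyp_area F | F in fundamental_set G].

Definition discrete_subgroup G := group_closed (mem G) /\ isolated G = G.

Definition nonuniform_lattice G :=
  [/\ discrete_subgroup G, (quotient_area G < +oo)%E &
      ~ compact [set: orbit_space G]].

(* |trace| = 2, stated for the square since the trace is defined up to sign;
   the identity is excluded. *)
Definition parabolic (g : PSL2 R) :=
  g <> 1%g /\ (ent_a g + ent_d g) ^+ 2 = 4.

Definition cusp G (x : option R) :=
  exists g, [/\ G g, parabolic g & bact g x = x].

End Lattices.

Section LagrangeSpectrum.
Context {R : realType}.
Implicit Types (G : set (PSL2 R)) (alpha k : R).

(* Infinitely many g in G with pairwise distinct images g . oo; the condition
   c(g) <> 0 says that g . oo = a(g) / c(g) is not oo. *)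
Definition approximable G alpha k :=
  exists S : set (PSL2 R),
    [/\ S `<=` G, infinite_set S, {in S &, injective (bact ^~ None)} &
        forall g, S g -> ent_c g != 0 /\
          `|alpha - ent_a g / ent_c g| < 1 / (k * ent_c g ^+ 2)].

(* The maximum with 0 makes the supremum of the empty set equal to 0, as it is
   in [0, +oo]. *)
Definition lagrange_const G alpha : \bar R :=
  maxe 0%E (ereal_sup [set k%:E | k in [set k | 0 < k /\ approximable G alpha k]]).

Definition lagrange_spectrum G : set (\bar R) := range (lagrange_const G).

End LagrangeSpectrum.

(* Main.v *)
From HB Require Import structures.
Require Import Defs.
From mathcomp Require Import all_boot all_order all_algebra.
From mathcomp Require Import complex ring lra.
From mathcomp Require Import all_classical all_reals all_analysis.
From mathcomp Require Import measurable_realfun measurable_fun_approximation.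

(** Why the theorem is true.  Let Gam be the preimage of G in SL2(R).  For A in
    Gam with lower row (c, d) and c <> 0 the number a / c is a cusp value, the
    point A . oo of the orbit of the cusp oo, and
      gap_A(x) = |c (c x - a)| = c ^ 2 |x - a / c|
    measures how well it approximates x; |c| is called its denominator.  Thus
    L_G(alpha) is the limsup of 1 / gap over the distinct cusp values.  It suffices to find eta > 0 such
    that for all l_0, l_1, ... >= 2 there are a number alpha and distinct cusp
    values s_i for which gap_(s_i)(alpha) - 1 / l_i tends to 0, all other gaps
    at alpha being >= eta ([prescribed_gaps]).  With l_i = L for L finite, and
    l_i tending to infinity for L = +oo, this yields L_G(alpha) = L for all
    L >= 2 + 1 / eta.

    In the classical argument a large L is written as a sum of two numbers with
    bounded continued fraction digits.  Their role is played here by points x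
    and y at distance L that are both badly approximable by cusp values.  By
    discreteness |c| >= m > 0 on Gam as soon as c <> 0
    ([fuchsian_lower_left]), hence cusp values with lower left entries c and c'
    are at distance at least m / |c c'| ([cuspval_sep]).  With a separation of
    this kind, a choice of nested intervals keeps y and y + L away from all cusp
    values at the same time ([badly_approximable_pair]).  No thickness of Cantor
    sets has to be compared.

    Cusp values are dense in R ([cusps_dense]), so x and y can be replaced by
    cusp values, again badly approximable by all the others ([good_cusp_near]).
    Now let F be in Gam, and let K and X be in Gam with K . oo = y and
    X . oo = x.  With a suitable translation T in Gam put G = F T K^-1 and
    consider the cusp value p' = G X . oo.  The geodesic from oo to p' is the
    image under G of the geodesic from G^-1 . oo, a point close to y, to x.  So
    its excursion into the cusp G . oo has size about x - y, that is, the gap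
    of G at p' is about 1 / L, and all other excursions beyond F . oo are bounded
    because x and y are badly approximable.  T is chosen such that the turn at
    F . oo is bounded as well ([pass_near_cusp]).  Iterating with F replaced by
    G X gives a sequence of cusp values which converges to alpha; the entries c
    grow so fast that later steps do not disturb the gaps obtained before.

    Density is where the finite area enters.  If the cusp values omit an
    interval around u, consider the points of the upper half-plane above a
    smaller interval.  An element of Gam that maps one of them to another one has
    bounded entries ([return_entries_bounded]), so each orbit meets this set a
    bounded number of times.  Its hyperbolic area is then at most a multiple of
    that of a fundamental set, but it is infinite.  The invariance of the area
    is seen in the coordinates s = x / y and t = ln y: there it is Lebesgue
    measure, and the Moebius maps z + u, k z and - 1 / z act by
      (s + u e^-t, t),  (s, t + ln k)  and  (- s, - t - ln (1 + s ^ 2)),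
    translations and reflections in one coordinate at a time. *)

Set Implicit Arguments.
Unset Strict Implicit.
Unset Printing Implicit Defensive.

Import Order.TTheory GRing.Theory Num.Theory.
Import numFieldNormedType.Exports.

Local Open Scope classical_set_scope.
Local Open Scope ring_scope.
Local Open Scope quotient_scope.

(** * Matrices and discrete groups containing a translation *)

Section Entries.
Context {R : realType}.
Implicit Types (A B : SL2 R).

Definition ea A : R := SL2mx A 0 0.
Definition eb A : R := SL2mx A 0 1.
Definition ec A : R := SL2mx A 1 0.
Definition ed A : R := SL2mx A 1 1.

Lemma SL2_detE A : ea A * ed A - eb A * ec A = 1.
Proof.
rewrite -(det_SL2 A) (expand_det_row _ 0) !big_ord_recl big_ord0 addr0.
rewrite /cofactor !det_mx11 !mxE /= expr0 mul1r expr1 mulN1r mulrN.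
by congr (_ * _ - _ * _); congr (SL2mx A _ _); apply/val_inj.
Qed.

Lemma ord2P (k : 'I_2) : k = 0 \/ k = 1.
Proof. by case: k => [[|[|?]]] // ?; [left|right]; apply/val_inj. Qed.

Lemma SL2_ext A B : ea A = ea B -> eb A = eb B -> ec A = ec B -> ed A = ed B ->
  A = B.
Proof.
move=> ha hb hc hd; apply/val_inj/matrixP => i j /=.
by case: (ord2P i) => ->; case: (ord2P j) => ->.
Qed.

Lemma eaM A B : ea (A * B)%g = ea A * ea B + eb A * ec B.
Proof.
rewrite /ea /= mxE !big_ord_recl big_ord0 addr0.
by congr (_ + SL2mx A _ _ * SL2mx B _ _); apply/val_inj.
Qed.
Lemma ebM A B : eb (A * B)%g = ea A * eb B + eb A * ed B.
Proof.
rewrite /eb /= mxE !big_ord_recl big_ord0 addr0.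
by congr (_ + SL2mx A _ _ * SL2mx B _ _); apply/val_inj.
Qed.
Lemma ecM A B : ec (A * B)%g = ec A * ea B + ed A * ec B.
Proof.
rewrite /ec /= mxE !big_ord_recl big_ord0 addr0.
by congr (_ + SL2mx A _ _ * SL2mx B _ _); apply/val_inj.
Qed.
Lemma edM A B : ed (A * B)%g = ec A * eb B + ed A * ed B.
Proof.
rewrite /ed /= mxE !big_ord_recl big_ord0 addr0.
by congr (_ + SL2mx A _ _ * SL2mx B _ _); apply/val_inj.
Qed.

Lemma SL2_entries1 : [/\ ea (1%g : SL2 R) = 1, eb (1%g : SL2 R) = 0,
  ec (1%g : SL2 R) = 0 & ed (1%g : SL2 R) = 1].
Proof. by split; rewrite /ea /eb /ec /ed /= mxE. Qed.

Lemma SL2_entriesV A : [/\ ea A^-1%g = ed A, eb A^-1%g = - eb A,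
  ec A^-1%g = - ec A & ed A^-1%g = ea A].
Proof.
have [h1 h2 h3 h4] := SL2_entries1; have D := SL2_detE A.
have := mulVg A; set B := A^-1%g => E.
move: (congr1 ea E) (congr1 eb E) (congr1 ec E) (congr1 ed E).
rewrite eaM ebM ecM edM h1 h2 h3 h4 => e1 e2 e3 e4.
move: e1 e2 e3 e4 D; move: (ea A) (eb A) (ec A) (ed A) (ea B) (eb B) (ec B) (ed B).
move=> a b c d a' b' c' d' e1 e2 e3 e4 D.
split.
- have -> : a' = (a' * a + b' * c) * d - (a' * b + b' * d) * c + a' * (1 - (a * d - b * c)) by ring.
  by rewrite e1 e2 D; ring.
- have -> : b' = (a' * b + b' * d) * a - (a' * a + b' * c) * b + b' * (1 - (a * d - b * c)) by ring.
  by rewrite e1 e2 D; ring.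
- have -> : c' = (c' * a + d' * c) * d - (c' * b + d' * d) * c + c' * (1 - (a * d - b * c)) by ring.
  by rewrite e3 e4 D; ring.
- have -> : d' = (c' * b + d' * d) * a - (c' * a + d' * c) * b + d' * (1 - (a * d - b * c)) by ring.
  by rewrite e3 e4 D; ring.
Qed.

Lemma eaV A : ea A^-1%g = ed A. Proof. by case: (SL2_entriesV A). Qed.
Lemma ebV A : eb A^-1%g = - eb A. Proof. by case: (SL2_entriesV A). Qed.
Lemma ecV A : ec A^-1%g = - ec A. Proof. by case: (SL2_entriesV A). Qed.
Lemma edV A : ed A^-1%g = ea A. Proof. by case: (SL2_entriesV A). Qed.

Definition entriesM := (eaM, ebM, ecM, edM, eaV, ebV, ecV, edV).

Definition entries_le (B : R) : set (SL2 R) :=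
  [set A | [/\ `|ea A| <= B, `|eb A| <= B, `|ec A| <= B & `|ed A| <= B]].

Definition translation (t : R) A := [/\ ea A = 1, eb A = t, ec A = 0 & ed A = 1].

(** Conjugates of a translation only involve the first column of A: they turn
    bounds on a and c into elements of the group with bounded entries. *)
Lemma translation_conj (t : R) A U : translation t U ->
  let V := (A * U * A^-1)%g in
  [/\ ea V = 1 - ea A * ec A * t, eb V = ea A ^+ 2 * t,
      ec V = - ec A ^+ 2 * t & ed V = 1 + ea A * ec A * t].
Proof.
move=> [ua ub uc ud]; have D := SL2_detE A.
by split; rewrite !entriesM ua ub uc ud -?[in RHS]D; ring.
Qed.

(** P need not be the smallest translation length.  Discreteness is the isolation
    of the identity, in terms of the entries. *)
Record fuchsian (Gam : set (SL2 R)) (P : R) : Prop := Fuchsian {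
  fuch1 : Gam 1%g ;
  fuchM : forall A B, Gam A -> Gam B -> Gam (A * B)%g ;
  fuchV : forall A, Gam A -> Gam A^-1%g ;
  fuch_discrete : exists2 eps, 0 < eps & forall A, Gam A ->
    `|ea A - 1| < eps -> `|eb A| < eps -> `|ec A| < eps -> `|ed A - 1| < eps ->
    A = 1%g ;
  fuch_width : 0 < P ;
  fuch_translation : exists2 T, Gam T & translation P T }.

End Entries.

Section Fuchsian.
Context {R : realType} (Gam : set (SL2 R)) (P : R) (fG : fuchsian Gam P).
Implicit Types (A B : SL2 R).

Lemma translations (j : int) : exists2 T, Gam T & translation (j%:~R * P) T.
Proof.
have [T GT [a1 bP c0 d1]] := fuch_translation fG.
have pos n : exists2 T, Gam T & translation (n%:R * P) T.
  elim: n => [|n [U GU [ua ub uc ud]]].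
    by exists 1%g; [exact: (fuch1 fG)|rewrite mul0r; exact: SL2_entries1].
  exists (T * U)%g; first exact: (fuchM fG).
  by split; rewrite entriesM ?(a1, bP, c0, d1, ua, ub, uc, ud) -?[n.+1]addn1 ?natrD; ring.
case: j => n; first by have [U ? ?] := pos n; exists U.
have [U GU [ua ub uc ud]] := pos n.+1; exists U^-1%g; first exact: (fuchV fG).
by split; rewrite entriesM ?(ua, ub, uc, ud) ?NegzE ?mulrNz ?mulNr ?oppr0.
Qed.

(** Cut the box of possible entries into small cubes: when A and B lie in the
    same cube, A^-1 B is so close to 1 that A = B. *)
Lemma fuchsian_finite (B : R) : finite_set (Gam `&` entries_le B).
Proof.
have [eps e0 H] := fuch_discrete fG.
pose C := `|B| + 1; have C0 : 0 < C by rewrite /C ltr_wpDl.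
pose dl := eps / (2 * C); have d0 : 0 < dl by rewrite divr_gt0 ?mulr_gt0.
pose cell (x : R) := Num.truncn ((x + C) / dl).
pose f A := (cell (ea A), cell (eb A), (cell (ec A), cell (ed A))).
pose K := (Num.truncn (2 * C / dl)).+1.
have bnd x : `|x| <= B -> `|x| <= C by move=> h; rewrite /C; have := ler_norm B; lra.
have cellK x : `|x| <= B -> (cell x < K)%N.
  move=> /bnd; rewrite ler_norml => /andP[? ?].
  by rewrite /K ltnS le_truncn // ler_pM2r ?invr_gt0 //; lra.
have cellE x y : `|x| <= B -> `|y| <= B -> cell x = cell y -> `|x - y| < dl.
  have ub z : (z + C) / dl < (cell z).+1%:R by exact: truncnS_gt.
  move=> /bnd; rewrite ler_norml => /andP[x1 x2].
  move=> /bnd; rewrite ler_norml => /andP[y1 y2] E.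
  have lb z : 0 <= z + C -> (cell z)%:R <= (z + C) / dl.
    by move=> z0; rewrite truncn_le // divr_ge0 // ltW.
  move: (ub x) (ub y) (lb x) (lb y); rewrite E -[(cell y).+1]addn1 natrD.
  rewrite !ltr_pdivrMr // !ler_pdivlMr // !mulrDl mul1r => p1 p2 p3 p4.
  have {}p3 := p3 ltac:(lra); have {}p4 := p4 ltac:(lra).
  by rewrite ltr_norml; apply/andP; split; lra.
have fin : finite_set (f @` (Gam `&` entries_le B)).
  apply: (@sub_finite_set _ _ ((`I_K `*` `I_K) `*` (`I_K `*` `I_K))).
    by move=> _ [A [_ [h1 h2 h3 h4]] <-]; do !split => /=; exact: cellK.
  by do !apply: finite_setX; exact: finite_II.
rewrite -(eq_finite_set (@inj_card_eq _ _ _ f _)) //.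
move=> A B' /set_mem[GA [a1 a2 a3 a4]] /set_mem[GB [b1 b2 b3 b4]].
move=> /pair_equal_spec[/pair_equal_spec[fa fb] /pair_equal_spec[fc fd]].
have pa := cellE _ _ a1 b1 fa; have pb := cellE _ _ a2 b2 fb.
have pc := cellE _ _ a3 b3 fc; have pd := cellE _ _ a4 b4 fd.
have lin x y u v : `|x| <= C -> `|y| <= C -> `|u| < dl -> `|v| < dl ->
    `|x * u - y * v| < eps.
  move=> hx hy hu hv; apply: le_lt_trans (ler_normB _ _) _; rewrite !normrM.
  have -> : eps = C * dl + C * dl by rewrite /dl; field; exact: lt0r_neq0.
  by apply: ltrD; apply: le_lt_trans (ler_wpM2r (normr_ge0 _) _) _;
    [exact: hx| |exact: hy|]; rewrite ltr_pM2l.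
have DA := SL2_detE A.
suff E : (A^-1 * B')%g = 1%g by rewrite -[LHS]mulg1 -E mulVKg.
apply: H; first by apply: (fuchM fG) => //; exact: (fuchV fG).
- rewrite !entriesM; have -> : ed A * ea B' + - eb A * ec B' - 1 =
    eb A * (ec A - ec B') - ed A * (ea A - ea B') by rewrite -DA; ring.
  by apply: lin => //; exact: bnd.
- rewrite !entriesM; have -> : ed A * eb B' + - eb A * ed B' =
    eb A * (ed A - ed B') - ed A * (eb A - eb B') by ring.
  by apply: lin => //; exact: bnd.
- rewrite !entriesM; have -> : - ec A * ea B' + ea A * ec B' =
    ec A * (ea A - ea B') - ea A * (ec A - ec B') by ring.
  by apply: lin => //; exact: bnd.
- rewrite !entriesM; have -> : - ec A * eb B' + ea A * ed B' - 1 =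
    ec A * (eb A - eb B') - ea A * (ed A - ed B') by rewrite -DA; ring.
  by apply: lin => //; exact: bnd.
Qed.

Lemma finite_set_gap (T : choiceType) (S : set T) (f : T -> R) : finite_set S ->
  exists2 m, 0 < m & forall x, S x -> f x != 0 -> m <= `|f x|.
Proof.
move=> /finite_seqP[s ->]; elim: s => [|x s [m m0 IH]].
  by exists 1.
have [fx0|fx0] := eqVneq (f x) 0.
  exists m => // y /=; rewrite inE => /orP[/eqP->|]; last exact: IH.
  by rewrite fx0 eqxx.
exists (Num.min m `|f x|); first by rewrite lt_min m0 normr_gt0.
move=> y /=; rewrite inE => /orP[/eqP-> _|ys fy]; first by rewrite ge_min lexx orbT.
by rewrite ge_min IH.
Qed.

(** After multiplication by a translation on the left |a| <= P |c|.  If |c| < 1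
    the conjugate by A of the translation by P has bounded entries, so that it
    belongs to a finite set, and its lower left entry is - c ^ 2 P. *)
Lemma fuchsian_lower_left :
  exists2 m, 0 < m & forall A, Gam A -> ec A != 0 -> m <= `|ec A|.
Proof.
have P0 := fuch_width fG.
have [T GT [ta tb tc td]] := fuch_translation fG.
pose B := 1 + P + P * P + P * P * P.
have [m m0 mP] := finite_set_gap ec (fuchsian_finite B).
exists (Num.min 1 (m / P)); first by rewrite lt_min ltr01 divr_gt0.
move=> A GA c0; rewrite ge_min; have [//|c1] /= := leP 1 `|ec A|.
pose n := Num.floor (ea A / (P * ec A)).
have [U GU [ua ub uc ud]] := translations (- n).
pose A' := (U * A)%g.
have ec' : ec A' = ec A by rewrite entriesM uc ud; ring.
have ea' : ea A' = ea A - n%:~R * P * ec A by rewrite entriesM ua ub mulrNz; ring.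
have aP : `|ea A'| <= P * `|ec A|.
  have -> : ea A' = (ea A / (P * ec A) - n%:~R) * (P * ec A).
    by rewrite ea'; field; rewrite c0 gt_eqF.
  rewrite normrM (normrM P) (gtr0_norm P0) -[leRHS]mul1r.
  apply: ler_wpM2r; first by rewrite mulr_ge0 // ltW.
  rewrite ger0_norm ?subr_ge0 ?floor_le //.
  by have := floorD1_gt (ea A / (P * ec A)); rewrite intrD; rewrite -/n; lra.
pose V := (A' * T * A'^-1)%g.
have GA' : Gam A' by exact: (fuchM fG).
have GV : Gam V.
  by apply: (fuchM fG); [apply: (fuchM fG)|apply: (fuchV fG)].
have [Va Vb Vc Vd] := translation_conj A' (And4 ta tb tc td).
have c1' : `|ec A'| <= 1 by rewrite ec' ltW.
have a1' : `|ea A'| <= P.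
  by apply: le_trans aP _; rewrite -[leRHS]mulr1 ler_pM2l // ltW.
have PP0 : 0 < P * P by rewrite mulr_gt0.
have PPP0 : 0 < P * P * P by rewrite mulr_gt0.
have acP : `|ea A' * ec A' * P| <= P * P.
  rewrite !normrM (gtr0_norm P0) ler_pM2r // -[leRHS]mulr1.
  by apply: ler_pM.
have /mP : (Gam `&` entries_le B) V.
  split=> //; split.
  - rewrite Va; apply: le_trans (ler_normB _ _) _; rewrite normr1 /B; lra.
  - rewrite Vb !normrM (gtr0_norm P0) /B.
    suff: `|ea A'| * `|ea A'| * P <= P * P * P by lra.
    by rewrite ler_pM2r //; apply: ler_pM.
  - rewrite Vc mulNr normrN !normrM (gtr0_norm P0) /B.
    suff: `|ec A'| * `|ec A'| * P <= 1 * 1 * P by lra.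
    by rewrite ler_pM2r //; apply: ler_pM.
  - rewrite Vd; apply: le_trans (ler_normD _ _) _; rewrite normr1 /B; lra.
have cP0 : ec A' ^+ 2 * P != 0 by rewrite mulf_neq0 ?expf_neq0 ?ec' // gt_eqF.
rewrite Vc mulNr normrN oppr_eq0 ec' => /(_ ltac:(by rewrite -ec')).
rewrite normrM (gtr0_norm P0) normrX ler_pdivrMr // => h.
apply: le_trans h _; rewrite ler_pM2r // expr2 -[leRHS]mul1r.
by rewrite ler_wpM2r // ltW.
Qed.

(** If A fixes oo and |a| < 1, conjugation by A contracts the translations of
    the group, against discreteness. *)
Lemma fuchsian_stabilizer A : Gam A -> ec A = 0 -> `|ea A| = 1.
Proof.
have P0 := fuch_width fG.
have [eps e0 H] := fuch_discrete fG.
have [T GT [ta tb tc td]] := fuch_translation fG.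
have main B : Gam B -> ec B = 0 -> ~ `|ea B| < 1.
  move=> GB c0 a1.
  have ad : ea B * ed B = 1 by have := SL2_detE B; rewrite c0 mulr0 subr0.
  have conj n : exists2 U, Gam U & translation (ea B ^+ (n + n)%N * P) U.
    elim: n => [|n [U GU [ua ub uc ud]]].
      by exists T => //; rewrite expr0 mul1r.
    exists (B * U * B^-1)%g.
      by apply: (fuchM fG); [apply: (fuchM fG)|apply: (fuchV fG)].
    rewrite /translation; have [-> -> -> ->] := translation_conj B (And4 ua ub uc ud).
    by split; rewrite ?c0 ?addnS ?addSn ?exprS; ring.
  have : (fun n => `|ea B| ^+ n) @ \oo --> (0 : R).
    by apply: cvg_expr; rewrite normr_id.
  move=> /cvgrPdist_lt /(_ (eps / P)); rewrite divr_gt0 // => /(_ isT)[N _ HN].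
  have [U GU [ua ub uc ud]] := conj N.
  have E : U = 1%g.
    apply: H; rewrite // ?ua ?ub ?uc ?ud ?subrr ?normr0 //.
    rewrite normrM (gtr0_norm P0) -ltr_pdivlMr //.
    have := HN (N + N)%N; rewrite /= sub0r normrN normrX normr_id -normrX; apply.
    by rewrite leq_addr.
  have := ub; rewrite E; have [_ -> _ _] := @SL2_entries1 R.
  move/esym/eqP; rewrite mulf_eq0 (gt_eqF P0) orbF expf_eq0 => /andP[_ /eqP a0].
  by move: ad; rewrite a0 mul0r => /eqP; rewrite eq_sym oner_eq0.
move=> GA c0; have ad : ea A * ed A = 1 by have := SL2_detE A; rewrite c0 mulr0 subr0.
have a0 : 0 < `|ea A|.
  by rewrite normr_gt0; apply/eqP => a0; move: ad; rewrite a0 mul0r => /eqP; rewrite eq_sym oner_eq0.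
have := main _ GA c0; have := main _ (fuchV fG GA); rewrite ecV c0 oppr0 eaV => /(_ erefl).
have -> : ed A = (ea A)^-1 by rewrite -[LHS]mul1r -[X in X * _](@mulVf _ (ea A)) -?normr_gt0 // -mulrA ad mulr1.
rewrite normfV invf_lt1 // => /negP; rewrite -leNgt => h1 /negP; rewrite -leNgt => h2.
by apply/eqP; rewrite eq_le h1 h2.
Qed.

End Fuchsian.

(** * Gaps between real points and cusp values *)

Section Gap.
Context {R : realType}.
Implicit Types (A B : SL2 R).

Definition cuspval A : R := ea A / ec A.

(** A^-1 maps the vertical geodesic ending at x to a semicircle, and the gap is
    the inverse of its diameter.  Written without division, so that the rules
    [cuspgap_ract] and [cuspgap_lipschitz] hold for all entries. *)
Definition cuspgap A (x : R) : R := `|ec A * (ec A * x - ea A)|.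

Lemma cuspgapE A x : ec A != 0 -> cuspgap A x = ec A ^+ 2 * `|x - cuspval A|.
Proof.
move=> c0; rewrite /cuspgap -[ec A ^+ 2]ger0_norm ?sqr_ge0 // -normrM.
by congr `|_|; rewrite /cuspval; field.
Qed.

Lemma ec_ratio A B : ec A != 0 -> ec B != 0 ->
  ec (A^-1 * B)%g = ec A * ec B * (cuspval A - cuspval B).
Proof. by move=> a0 b0; rewrite !entriesM /cuspval; field; rewrite ?a0 ?b0. Qed.

End Gap.

Lemma nested_balls (R : realType) (x r : nat -> R) :
  (forall n, `|x n.+1 - x n| <= r n - r n.+1) -> (forall n, 0 <= r n) ->
  exists y, forall n, `|y - x n| <= r n.
Proof.
move=> xr r0.
have lo : nondecreasing_seq (fun n => x n - r n).
  by apply/nondecreasing_seqP => n; have := xr n; rewrite ler_norml => /andP[? ?]; lra.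
have hi : nonincreasing_seq (fun n => x n + r n).
  by apply/nonincreasing_seqP => n; have := xr n; rewrite ler_norml => /andP[? ?]; lra.
have lohi i j : x i - r i <= x j + r j.
  have h1 := lo _ _ (leq_maxl i j); have h2 := hi _ _ (leq_maxr i j).
  by have := r0 (maxn i j); lra.
exists (sup (range (fun n => x n - r n))) => n; rewrite ler_norml; apply/andP; split.
  rewrite lerBrDr addrC; apply: ub_le_sup; last by exists n.
  by exists (x 0%N + r 0%N) => _ [i _ <-].
by rewrite lerBlDl; apply: ge_sup; [exists (x n - r n), n|move=> _ [i _ <-]].
Qed.

Section Approximation.
Context {R : realType} (Gam : set (SL2 R)) (P : R) (fG : fuchsian Gam P).
Context (m : R) (m0 : 0 < m).
Context (mP : forall A, Gam A -> ec A != 0 -> m <= `|ec A|).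
Implicit Types (A B : SL2 R) (y z l : R) (n : nat).

(** The lower left entry of A^-1 B is ec A * ec B times the distance of the two
    cusp values, and it is bounded below when it does not vanish. *)
Lemma cuspval_sep A B : Gam A -> Gam B -> ec A != 0 -> ec B != 0 ->
  cuspval A != cuspval B -> m <= `|ec A| * `|ec B| * `|cuspval A - cuspval B|.
Proof.
move=> GA GB a0 b0 ne; rewrite -!normrM -ec_ratio //; apply: mP.
  by apply: (fuchM fG) => //; exact: (fuchV fG).
by rewrite ec_ratio // !mulf_neq0 // subr_eq0.
Qed.

Lemma cuspval_eq A B : Gam A -> Gam B -> ec A != 0 -> ec B != 0 ->
  cuspval A = cuspval B -> `|ec A| = `|ec B|.
Proof.
move=> GA GB a0 b0 e; pose S := (A^-1 * B)%g.
have GS : Gam S by apply: (fuchM fG) => //; exact: (fuchV fG).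
have cS : ec S = 0 by rewrite ec_ratio // e subrr mulr0.
have -> : B = (A * S)%g by rewrite mulVKg.
by rewrite ecM cS mulr0 addr0 normrM (fuchsian_stabilizer fG GS cS) mulr1.
Qed.

(** The width of the windows used at step n of the construction of a badly
    approximable point. *)
Let scale n : R := (5 * m * 5 ^+ n)^-1.

Let scale_gt0 n : 0 < scale n.
Proof. by rewrite invr_gt0 !mulr_gt0 ?exprn_gt0. Qed.

Let scaleS n : scale n.+1 = scale n / 5.
Proof. by rewrite /scale exprS mulrCA invfM mulrC. Qed.

(** The matrices treated at step n; their cusp values are so far apart that a
    window of width [scale n] sees at most one of them. *)
Let level n A := [/\ Gam A, ec A != 0, m / 10 < ec A ^+ 2 * scale n &
  ec A ^+ 2 * scale n <= m / 2].

Let level_exists A : Gam A -> ec A != 0 -> exists n, level n A.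
Proof.
move=> GA c0; have m0' := m0.
have c2 : m ^+ 2 <= ec A ^+ 2.
  rewrite -[leRHS](real_normK (num_real (ec A))).
  by rewrite ler_sqr ?nnegrE ?normr_ge0 ?(ltW m0) // mP.
have ex : exists n, ec A ^+ 2 * scale n <= m / 2.
  have [N HN] : exists N, ec A ^+ 2 / (5 / 2 * m ^+ 2) < N%:R.
    exists (Num.truncn (ec A ^+ 2 / (5 / 2 * m ^+ 2))).+1; exact: truncnS_gt.
  exists N; rewrite /scale ler_pdivrMr ?mulr_gt0 ?exprn_gt0 //.
  have h5 : N%:R <= 5 ^+ N :> R by rewrite -natrX ler_nat ltnW // ltn_expl.
  move: HN; rewrite ltr_pdivrMr ?mulr_gt0 ?exprn_gt0 // => HN.
  have w0 : 0 <= 5 / 2 * m ^+ 2 by rewrite mulr_ge0 ?sqr_ge0.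
  have := ler_wpM2r w0 h5.
  by rewrite expr2 in HN *; lra.
case: (ex_minnP ex) => n nP nmin; exists n; split=> //.
case: n nP nmin => [|n] nP nmin.
  rewrite /scale expr0 mulr1 ltr_pdivlMr ?mulr_gt0 //; move: c2.
  by rewrite [m ^+ 2]expr2; have := mulr_gt0 m0 m0; lra.
have {nmin} : ~~ (ec A ^+ 2 * scale n <= m / 2).
  by apply/negP => /nmin; rewrite ltnn.
by rewrite -ltNge scaleS; lra.
Qed.

Let level_sep n A B : level n A -> level n B -> cuspval A != cuspval B ->
  2 * scale n <= `|cuspval A - cuspval B|.
Proof.
move=> [GA a0 _ aS] [GB b0 _ bS] ne; have S := cuspval_sep GA GB a0 b0 ne.
have amgm : `|ec A| * `|ec B| <= (ec A ^+ 2 + ec B ^+ 2) / 2.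
  rewrite -[ec A ^+ 2]real_normK ?num_real // -[ec B ^+ 2]real_normK ?num_real //.
  rewrite ler_pdivlMr // -subr_ge0.
  have -> : `|ec A| ^+ 2 + `|ec B| ^+ 2 - `|ec A| * `|ec B| * 2 =
    (`|ec A| - `|ec B|) ^+ 2 by ring.
  exact: sqr_ge0.
have cAB : `|ec A| * `|ec B| * scale n <= m / 2.
  by have := ler_wpM2r (ltW (scale_gt0 n)) amgm; lra.
rewrite -(ler_pM2l (_ : 0 < `|ec A| * `|ec B|)) ?mulr_gt0 ?normr_gt0 //.
by apply: le_trans S; lra.
Qed.

(** The margin [scale n / 10] leaves room for all later steps. *)
Let clear n z := forall A, level n A ->
  scale n / 10 + m / 100 / ec A ^+ 2 <= `|z - cuspval A|.

Let steps : seq R := [:: -1; 0; 1].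

Let step_le1 e : e \in steps -> `|e| <= 1.
Proof. by rewrite !inE => /or3P[]/eqP->; rewrite ?normrN ?normr1 ?normr0. Qed.

Let steps_far e f : e \in steps -> f \in steps -> e != f -> 1 <= `|e - f|.
Proof.
rewrite !inE => /or3P[]/eqP-> /or3P[]/eqP->; rewrite ?eqxx // => _;
  by rewrite ler_normr; apply/orP; lra.
Qed.

(** Two of the three candidates cannot both be too close to cusp values of the
    level: to one and the same value because the candidates are too far apart,
    to two different values because those are too far apart. *)
Let clear_but_one n z : exists f : R, forall e, e \in steps -> e != f ->
  clear n (z + e * (2 / 5 * scale n)).
Proof.
set w := 2 / 5 * scale n; have s0 := scale_gt0 n; have m0' := m0.
have w0 : 0 < w by rewrite mulr_gt0.
have near e : ~ clear n (z + e * w) ->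
    exists2 A, level n A & `|z + e * w - cuspval A| < scale n / 5.
  move=> /existsNP[A /not_implyP[LA /negP]]; rewrite -ltNge => h; exists A => //.
  apply: lt_le_trans h _; case: LA => _ c0 c1 _.
  suff: m / 100 / ec A ^+ 2 <= scale n / 10 by lra.
  by rewrite ler_pdivrMr ?exprn_even_gt0 //; lra.
have [[f [fs fbad]]|none] := pselect (exists f, f \in steps /\
    ~ clear n (z + f * w)); last first.
  by exists 0 => e es _; apply: contrapT => bad; apply: none; exists e.
exists f => e es ef; apply: contrapT => /near[A LA hA].
have [B LB hB] := near _ fbad.
set u := z + e * w - cuspval A in hA; set v := z + f * w - cuspval B in hB.
have uv : `|u - v| < w.
  apply: le_lt_trans (ler_normB _ _) _.
  by apply: lt_le_trans (ltrD hA hB) _; rewrite /w; lra.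
have uvE : u - v = (e - f) * w - (cuspval A - cuspval B) by rewrite /u /v; ring.
have AB : cuspval A != cuspval B.
  apply/eqP => E; move: uv; rewrite uvE E subrr subr0 normrM (gtr0_norm w0).
  by rewrite ltNge ler_peMl ?(ltW w0) // steps_far.
have sep := level_sep LA LB AB.
have efw : `|(e - f) * w| <= 2 * w.
  rewrite normrM (gtr0_norm w0) ler_pM2r //.
  by apply: le_trans (ler_normB _ _) _; have := step_le1 es; have := step_le1 fs; lra.
have := lerB_dist (cuspval A - cuspval B) ((e - f) * w).
rewrite (distrC (cuspval A - cuspval B)) -uvE; move: efw uv; rewrite /w; lra.
Qed.

Let clear_step n y l : exists z,
  [/\ `|z - y| <= 2 / 5 * scale n, clear n z & clear n (z + l)].
Proof.
have [f0 h0] := clear_but_one n y; have [f1 h1] := clear_but_one n (y + l).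
have [e es /andP[ne0 ne1]] : exists2 e, e \in steps & (e != f0) && (e != f1).
  apply: contrapT => none.
  have : {subset steps <= [:: f0; f1]}.
    move=> e es; rewrite !inE; case: eqP => //= /eqP ne0; apply/negPn/negP => ne1.
    by apply: none; exists e; rewrite ?ne0.
  have us : uniq steps.
    by rewrite /= !inE !negb_or !andbT -!andbA; apply/and3P; split; apply/eqP; lra.
  by move=> /(uniq_leq_size us).
exists (y + e * (2 / 5 * scale n)); split; [|exact: h0|by rewrite addrAC; exact: h1].
rewrite addrC addKr normrM (gtr0_norm (_ : 0 < 2 / 5 * scale n)) ?mulr_gt0 //.
by apply: ler_piMl; [rewrite mulr_ge0 // ltW|exact: step_le1].
Qed.

(** Nested windows of widths [scale n], the next one always among three
    candidates: at level n the cusp values spoil at most one candidate for y and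
    at most one for y + l. *)
Lemma badly_approximable_pair l : exists y, forall A, Gam A -> ec A != 0 ->
  m / 100 <= cuspgap A y /\ m / 100 <= cuspgap A (y + l).
Proof.
pose next n y := sval (cid (clear_step n y l)).
pose x := fix x n := if n is n'.+1 then next n' (x n') else 0.
have xP n : [/\ `|x n.+1 - x n| <= 2 / 5 * scale n, clear n (x n.+1) &
    clear n (x n.+1 + l)] by exact: (svalP (cid (clear_step n (x n) l))).
have r1 n : `|x n.+1 - x n| <= scale n / 2 - scale n.+1 / 2.
  by have [h _ _] := xP n; apply: le_trans h _; rewrite scaleS; lra.
have r2 n : 0 <= scale n / 2 by rewrite divr_ge0 // ltW.
have [y yP] := nested_balls r1 r2.
exists y => A GA c0; have [n LA] := level_exists GA c0.
have main b : clear n (x n.+1 + b) -> m / 100 <= cuspgap A (y + b).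
  move=> /(_ A LA) h; rewrite cuspgapE //.
  have c20 : 0 < ec A ^+ 2 by rewrite exprn_even_gt0.
  rewrite [leRHS]mulrC -ler_pdivrMr //; move: h; set w := m / 100 / _ => h.
  have := yP n.+1; rewrite scaleS => h2.
  have := lerB_dist (x n.+1 + b - cuspval A) (x n.+1 - y).
  have -> : x n.+1 + b - cuspval A - (x n.+1 - y) = y + b - cuspval A by ring.
  by rewrite (distrC _ y); lra.
case: (xP n) => _ f1 f2; split; last exact: main.
by rewrite -[y]addr0; apply: main; rewrite addr0.
Qed.

End Approximation.

Record dense_fuchsian (R : realType) (Gam : set (SL2 R)) (P m : R) : Prop := DenseFuchsian {
  df_fuchsian : fuchsian Gam P ;
  df_gt0 : 0 < m ;
  df_lower_left : forall A, Gam A -> ec A != 0 -> m <= `|ec A| ;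
  df_dense : forall (x d : R), 0 < d ->
    exists A, [/\ Gam A, ec A != 0 & `|cuspval A - x| < d] }.

Section GoodCusp.
Context {R : realType} (Gam : set (SL2 R)) (P m : R).
Context (dG : dense_fuchsian Gam P m).
Implicit Types (A B : SL2 R) (l z d T : R).

(** The constant is smaller than in [badly_approximable_pair] by what is lost in
    [good_cusp_near] when a number is replaced by a cusp value. *)
Definition good_cusp X := [/\ Gam X, ec X != 0 & forall A, Gam A -> ec A != 0 ->
  cuspval A != cuspval X -> m / 400 <= cuspgap A (cuspval X)].

(** Start with a cusp value p very close to z.  Among the cusp values with gap
    smaller than m / 200 at p, choose one with nearly minimal denominator.  A
    cusp value too close to it would have a much smaller denominator and still
    a small gap at p.  The chosen one is near z, because z is badly approximable
    and hence its denominator is large. *)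
Lemma good_cusp_near z d T : 0 < d ->
  (forall A, Gam A -> ec A != 0 -> m / 100 <= cuspgap A z) ->
  exists X, [/\ good_cusp X, T <= `|ec X| & `|cuspval X - z| < d].
Proof.
move=> d0 zP; have [fG m0 mP dense_cusps] := dG.
pose d' := Num.min (d / 2) (m / 200 / (T ^+ 2 + 1)).
have T1 : 0 < T ^+ 2 + 1 by rewrite ltr_wpDl ?sqr_ge0.
have d'0 : 0 < d' by rewrite lt_min !divr_gt0.
have d'd : d' <= d / 2 by rewrite ge_min lexx.
have d'T : (T ^+ 2 + 1) * d' <= m / 200.
  by rewrite mulrC -ler_pdivlMr // ge_min lexx orbT.
have [A0 [GA0 a0 zA0]] := dense_cusps z d' d'0; set p := cuspval A0 in zA0.
(* A nearly minimal denominator: |ec X| < inf E + m <= 2 inf E. *)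
pose S := [set A | [/\ Gam A, ec A != 0 & cuspgap A p < m / 200]].
pose E := [set `|ec A| | A in S].
have SA0 : S A0.
  by split=> //; rewrite cuspgapE // subrr normr0 mulr0 divr_gt0.
have lbE : lbound E m by move=> _ [A [GA cA _] <-]; exact: mP.
have hE : has_inf E by split; [exists `|ec A0|, A0|exists m].
have [_ [X SX <-] ltX] := inf_adherent m0 hE.
have infm : m <= inf E by apply: lb_le_inf lbE; exists `|ec A0|, A0.
have infS A : S A -> inf E <= `|ec A|.
  by move=> SA; apply: ge_inf; [exists m|exists A].
case: (SX) => GX cX; rewrite cuspgapE // => pX.
have c20 : 0 < ec X ^+ 2 by rewrite exprn_even_gt0.
have zX := zP X GX cX; rewrite cuspgapE // in zX.
have cz : m / 200 < ec X ^+ 2 * d'.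
  have : `|z - cuspval X| <= `|p - z| + `|p - cuspval X|.
    by rewrite (distrC p z); exact: ler_distD.
  move=> /(ler_wpM2l (ltW c20)); rewrite mulrDr.
  have : ec X ^+ 2 * `|p - z| < ec X ^+ 2 * d' by rewrite ltr_pM2l.
  by move: pX zX; lra.
exists X; split.
- split=> // A GA cA qAX; rewrite leNgt; apply/negP => bad.
  have sep := cuspval_sep fG mP GA GX cA cX qAX.
  rewrite cuspgapE // in bad.
  have nA : 0 < `|ec A| by rewrite normr_gt0.
  have nX : 0 < `|ec X| by rewrite normr_gt0.
  have EA : ec A ^+ 2 = `|ec A| ^+ 2 by rewrite real_normK ?num_real.
  have EX : ec X ^+ 2 = `|ec X| ^+ 2 by rewrite real_normK ?num_real.
  have small : 400 * `|ec A| < `|ec X|.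
    rewrite ltNge; apply/negP => h.
    have : m <= `|ec A| * (400 * `|ec A|) * `|cuspval A - cuspval X|.
      by apply: le_trans sep _; rewrite ler_wpM2r // ler_wpM2l // ltW.
    by move: bad; rewrite distrC EA expr2; lra.
  have SA : S A.
    split=> //; rewrite cuspgapE //.
    have : ec A ^+ 2 * `|p - cuspval A| <=
        ec A ^+ 2 * `|p - cuspval X| + ec A ^+ 2 * `|cuspval X - cuspval A|.
      by rewrite -mulrDr ler_wpM2l ?sqr_ge0 //; exact: ler_distD.
    have : ec A ^+ 2 * `|p - cuspval X| <= ec X ^+ 2 * `|p - cuspval X| / 4.
      rewrite [leRHS]mulrAC ler_wpM2r // EA EX !expr2; nra.
    by move: m0 bad pX; lra.
  by have := infS A SA; move: m0 ltX small infm; lra.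
- have h : T ^+ 2 < `|ec X| ^+ 2.
    rewrite real_normK ?num_real // -(ltr_pM2r d'0); apply: le_lt_trans cz.
    by move: d'T; rewrite mulrDl; lra.
  rewrite leNgt; apply/negP => hT; move: h; apply/negP; rewrite -leNgt.
  by rewrite ler_sqr ?nnegrE ?normr_ge0 // ?(ltW hT) // (le_trans _ (ltW hT)).
- have pX' : `|p - cuspval X| < d'.
    by rewrite -(ltr_pM2l c20); apply: lt_trans pX cz.
  have : `|cuspval X - z| <= `|p - cuspval X| + `|p - z|.
    by rewrite (distrC p (cuspval X)); exact: ler_distD.
  by move: zA0; lra.
Qed.

(** The denominator of the second cusp value can be chosen as a function of the
    first cusp value; [prescribed_gaps] relies on this order. *)
Lemma good_cusp_pair l d T : 0 < d ->
  exists Y, [/\ good_cusp Y, T <= `|ec Y| & forall T', exists X,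
    [/\ good_cusp X, T' <= `|ec X| & `|cuspval X - cuspval Y - l| < d]].
Proof.
move=> d0; have [fG m0 mP _] := dG.
have [y yP] := badly_approximable_pair fG m0 mP l.
have d20 : 0 < d / 2 by rewrite divr_gt0.
have [Y [gY cY Yy]] := good_cusp_near T d20 (fun A GA cA => (yP A GA cA).1).
exists Y; split=> // T'.
have [X [gX cX Xy]] := good_cusp_near T' d20 (fun A GA cA => (yP A GA cA).2).
exists X; split=> //.
have -> : cuspval X - cuspval Y - l = (cuspval X - (y + l)) - (cuspval Y - y) by ring.
by apply: le_lt_trans (ler_normB _ _) _; move: Yy Xy; lra.
Qed.

End GoodCusp.

(** * Passing near a given cusp value, then near a prescribed one *)

Section Act.
Context {R : realType}.
Implicit Types (A B : SL2 R) (x y a c e : R).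

Definition ract A x : R := (ea A * x + eb A) / (ec A * x + ed A).

Lemma ract_den A B x : ec B * x + ed B != 0 ->
  ec (A * B)%g * x + ed (A * B)%g = (ec A * ract B x + ed A) * (ec B * x + ed B).
Proof. by move=> d0; rewrite !entriesM /ract; field. Qed.

Lemma ract_comp A B x : ec B * x + ed B != 0 -> ec A * ract B x + ed A != 0 ->
  ract (A * B)%g x = ract A (ract B x).
Proof.
move=> d0 d1; rewrite {1}/ract ract_den // [in RHS]/ract.
apply: (mulIf (mulf_neq0 d1 d0)); rewrite divfK ?mulf_neq0 //.
rewrite mulrA divfK // !entriesM /ract; field; exact: d0.
Qed.

Lemma ract_cuspval A B : ec B != 0 -> ec A * cuspval B + ed A != 0 ->
  cuspval (A * B)%g = ract A (cuspval B).
Proof.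
move=> b0 d1; have E : ec (A * B)%g = (ec A * cuspval B + ed A) * ec B.
  by rewrite !entriesM /cuspval; field.
rewrite {1}/cuspval E; apply: (mulIf (mulf_neq0 d1 b0)).
rewrite divfK ?mulf_neq0 // mulrA divfK // !entriesM /cuspval; field; exact: b0.
Qed.

Lemma ract_linear A B x : ec A * x + ed A != 0 ->
  ec (A * B)%g * ract A x - ea (A * B)%g = (ec B * x - ea B) / (ec A * x + ed A).
Proof.
move=> d0; apply: (mulIf d0); rewrite divfK // mulrBl -mulrA divfK // !entriesM.
by rewrite -[RHS]mul1r -[in RHS](SL2_detE A); ring.
Qed.

(** The transformation rule of gaps: with y = A^-1 . oo the right-hand side is
    c ^ 2 |x - q| |y - q| / |x - y|, where q = B . oo and c = ec B are finite and
    nonzero, the inverse of the diameter of the semicircle to which B^-1 maps the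
    geodesic from y to x. *)
Lemma cuspgap_ract A B x : ec A * x + ed A != 0 ->
  cuspgap (A * B)%g (ract A x) =
  `|ec (A * B)%g| * `|ec B * x - ea B| / `|ec A * x + ed A|.
Proof. by move=> d0; rewrite /cuspgap ract_linear // !normrM normfV mulrA. Qed.

(** A geodesic whose two endpoints are badly approximable has bounded
    excursions: the endpoint farther from the cusp value a / c is at distance at
    least |x - y| / 2 from it. *)
Lemma two_sided_gap c a x y e : x != y -> c != 0 ->
  e <= `|c| * `|c * x - a| -> e <= `|c| * `|c * y - a| ->
  e / 2 <= `|c * x - a| * `|c * y - a| / `|x - y|.
Proof.
move=> xy c0 ex ey; have d0 : 0 < `|x - y| by rewrite normr_gt0 subr_eq0.
have nc : 0 < `|c| by rewrite normr_gt0.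
rewrite ler_pdivlMr //.
have tri : `|c| * `|x - y| <= `|c * x - a| + `|c * y - a|.
  rewrite -normrM; have -> : c * (x - y) = (c * x - a) - (c * y - a) by ring.
  exact: ler_normB.
have X0 := normr_ge0 (c * x - a); have Y0 := normr_ge0 (c * y - a).
move: tri ex ey X0 Y0; move: `|c * x - a| `|c * y - a| `|x - y| `|c| d0 nc => X Y D C.
move=> D0 C0 tri eX eY X0 Y0.
have [h|h] := lerP (C * D) (2 * Y).
  have : X * (C * D) <= X * (2 * Y) by rewrite ler_wpM2l.
  have : e * D <= (C * X) * D by rewrite ler_pM2r.
  by move=> ? ?; lra.
have : Y * (C * D) <= Y * (2 * X) by rewrite ler_wpM2l //; lra.
have : e * D <= (C * Y) * D by rewrite ler_pM2r.
by move=> ? ?; lra.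
Qed.

End Act.

Section Bridge.
Context {R : realType}.
Implicit Types (F K A : SL2 R) (s x : R).

(** The entries of A = T K^-1 for the translation T by s. *)
Definition bridge s K A :=
  [/\ ea A = ed K - s * ec K, eb A = - eb K + s * ea K, ec A = - ec K & ed A = ea K].

(** With x' = A . x = T K^-1 . x and y' = F^-1 . oo, the difference y' - x' is
    [turn_at s F K x], up to sign the diameter of the semicircle to which
    F^-1 maps the vertical geodesic ending at F A x.  Its limit for ec K large is
    [turn s F K]. *)
Definition turn s F K : R := ed K / ec K - ed F / ec F - s.
Definition turn_at s F K x : R := turn s F K + (ec K ^+ 2 * (x - cuspval K))^-1.

Context (s : R) (F K A : SL2 R).
Hypotheses (KA : bridge s K A) (f0 : ec F != 0) (k0 : ec K != 0).

Lemma ec_bridge : ec (F * A)%g = ec F * ec K * turn s F K.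
Proof.
by have [a b c d] := KA; rewrite ecM a c /turn; field; rewrite ?k0 ?f0.
Qed.

Lemma bridge_den x : ec A * x + ed A = - (ec K * (x - cuspval K)).
Proof. by have [_ _ -> ->] := KA; rewrite /cuspval; field. Qed.

Lemma glued_den x : x != cuspval K -> ec (F * A)%g * x + ed (F * A)%g =
  ec F * ec K * (x - cuspval K) * turn_at s F K x.
Proof.
move=> xK; have [a b c d] := KA.
have -> : ec F * ec K * (x - cuspval K) * turn_at s F K x =
    ec F * ec K * (x - cuspval K) * turn s F K + ec F / ec K.
  rewrite /turn_at; move: (turn s F K) (cuspval K) xK => t y xy.
  by field; rewrite subr_eq0 xy k0.
have -> : ec F / ec K = ec F * (ea K * ed K - eb K * ec K) / ec K.
  by rewrite SL2_detE mulr1.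
by rewrite ec_bridge edM b d /turn /cuspval; field; rewrite ?k0 ?f0.
Qed.

Lemma base_den x : x != cuspval K ->
  ec F * ract A x + ed F = - (ec F * turn_at s F K x).
Proof.
move=> xK; have d0 : ec A * x + ed A != 0.
  by rewrite bridge_den oppr_eq0 mulf_neq0 // subr_eq0.
by apply: (mulIf d0); rewrite -ract_den // glued_den // bridge_den; ring.
Qed.

End Bridge.

Lemma ratio_close (R : realType) (Z W u l d : R) : 3 / 2 <= W -> `|W - Z| <= d ->
  1 <= u -> `|u - l| <= d -> 2 <= l -> `|Z / (u * W) - l^-1| <= d + d.
Proof.
move=> W1 WZ u1 ul l2.
have -> : Z / (u * W) - l^-1 = (Z - W) / (u * W) + (l - u) / (u * l).
  by field; rewrite !gt_eqF //; lra.
have small r t : `|r| <= d -> 1 <= t -> `|r / t| <= d.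
  move=> rd t1; have t0 : 0 < t by lra.
  by rewrite normrM normfV (gtr0_norm t0) ler_pdivrMr // -[leLHS]mulr1; apply: ler_pM.
apply: le_trans (ler_normD _ _) _; apply: lerD; apply: small; rewrite 1?distrC //.
  by rewrite -[leLHS]mulr1; apply: ler_pM => //; lra.
by rewrite -[leLHS]mulr1; apply: ler_pM => //; lra.
Qed.

(** The three lower bounds met in [glued_gap]: gaps controlled by the two good cusps, gaps
    controlled by the distance of two cusp values, and the gap at F . oo
    itself. *)
Definition gap_bound (R : realType) (P m k : R) : R :=
  Num.min (m / 40 / 40) (Num.min (k * m / 2) (3 + P)^-1).

(** Seen from the cusp F . oo, the geodesic to F A Xi . oo runs from y' to x'.
    The gap of a cusp value at x' is that of the geodesic from K . oo to Xi . oo,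
    bounded below because these are good cusps.  Its gap at y' is bounded below
    because its denominator is not much smaller than that of F.  Both uses are
    instances of [two_sided_gap]. *)
Lemma glued_gap (R : realType) (Gam : set (SL2 R)) (P m k s : R) (F K A Xi U : SL2 R) :
  dense_fuchsian Gam P m -> 0 <= k -> bridge s K A -> Gam F -> ec F != 0 ->
  Gam A -> good_cusp Gam m K -> good_cusp Gam m Xi ->
  cuspval Xi != cuspval K -> 0 < turn_at s F K (cuspval Xi) <= 3 + P ->
  ec (F * A)%g != 0 ->
  Gam U -> ec U != 0 -> k * `|ec F| <= `|ec U| ->
  cuspval U != cuspval (F * A)%g -> cuspval U != cuspval (F * A * Xi)%g ->
  gap_bound P m k <= cuspgap U (ract (F * A)%g (cuspval Xi)).
Proof.
move=> [fG m0 mP _] kge0 KA GF f0 GA [GK k0 Kgood] [GX x0 Xgood] xK /andP[W0 WP] g0 GU u0 kU qUG qUX.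
set G := (F * A)%g in g0 qUG qUX *; set x := cuspval Xi in xK W0 WP Xgood *.
set W := turn_at s F K x in W0 WP.
have GG : Gam G by exact: (fuchM fG).
have nF : 0 < `|ec F| by rewrite normr_gt0.
have denG0 : ec G * x + ed G != 0.
  by rewrite (glued_den KA) // !mulf_neq0 ?subr_eq0 // gt_eqF.
have denA0 : ec A * x + ed A != 0.
  by rewrite (bridge_den KA k0) oppr_eq0 mulf_neq0 // subr_eq0.
have denF := base_den KA f0 k0 xK; rewrite -/W in denF.
set r := ract A x in denF.
have denF0 : ec F * r + ed F != 0 by rewrite denF oppr_eq0 mulf_neq0 // gt_eqF.
rewrite ract_comp // -/r.
pose w := (G^-1 * U)%g; pose v := (F^-1 * U)%g.
have Uw : U = (G * w)%g by rewrite mulVKg.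
have Uv : U = (F * v)%g by rewrite mulVKg.
have vw : v = (A * w)%g by rewrite /v Uw /G -mulgA mulKg.
have Gw : Gam w by apply: (fuchM fG) => //; exact: (fuchV fG).
have Gv : Gam v by apply: (fuchM fG) => //; exact: (fuchV fG).
have w0 : ec w != 0 by rewrite ec_ratio // !mulf_neq0 // subr_eq0 eq_sym.
have gapU : cuspgap U (ract F r) = `|ec v * r - ea v| * `|ec U| / `|ec F| / W.
  rewrite {1}Uv cuspgap_ract // -Uv denF normrN normrM (gtr0_norm W0) invfM !mulrA.
  by congr (_ / _ / _); rewrite mulrC.
have [v0|v0] := eqVneq (ec v) 0.
  rewrite /gap_bound !ge_min; apply/orP; right; apply/orP; right.
  have av : `|ea v| = 1 by exact: (fuchsian_stabilizer fG).
  have cU : `|ec U| = `|ec F| by rewrite {1}Uv ecM v0 mulr0 addr0 normrM av mulr1.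
  rewrite gapU v0 mul0r sub0r normrN av cU mul1r divff ?gt_eqF // mul1r.
  by rewrite lef_pV2 ?posrE // (lt_le_trans W0).
pose Y := - ed F / ec F.
have YU : `|ec v * Y - ea v| = `|ec U| / `|ec F|.
  rewrite -normfV -normrM -normrN; congr `|_|.
  by rewrite Uv !entriesM /Y; field.
have rY : r - Y = - W.
  by apply: (mulfI f0); rewrite mulrN -denF /Y; field.
have -> : cuspgap U (ract F r) =
    `|ec v * r - ea v| * `|ec v * Y - ea v| / `|r - Y|.
  by rewrite gapU YU rY normrN (gtr0_norm W0) !mulrA.
pose e := Num.min (m / 800) (k * m).
have e2 : gap_bound P m k <= e / 2.
  rewrite /gap_bound /e; have [h|h] := leP (m / 800) (k * m).
    by rewrite ge_min; apply/orP; left; lra.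
  by rewrite ge_min; apply/orP; right; rewrite ge_min lexx.
apply: le_trans e2 _; apply: two_sided_gap => //.
- by rewrite -subr_eq0 rY oppr_eq0 gt_eqF.
- have vr : ec v * r - ea v = (ec w * x - ea w) / (ec A * x + ed A).
    by rewrite vw ract_linear.
  have cv : ec v = ec K * (ec w * cuspval K - ea w).
    by have [_ _ c d] := KA; rewrite vw ecM c d /cuspval; field.
  have -> : `|ec v| * `|ec v * r - ea v| =
      `|ec w * x - ea w| * `|ec w * cuspval K - ea w| / `|x - cuspval K|.
    rewrite vr cv (bridge_den KA k0) -!normrM -normfV -normrM -[RHS]normrN.
    move: (cuspval K) xK => y xy.
    by congr `|_|; field; rewrite k0 subr_eq0 xy.
  have em : e <= m / 800 by rewrite /e ge_min lexx.
  have {em} em : e * 2 <= m / 400 by clear -em; lra.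
  rewrite -[e](@mulfK _ 2) ?pnatr_eq0 //.
  apply: two_sided_gap => //; apply: le_trans em _.
  + have := Xgood w Gw w0; rewrite /cuspgap normrM; apply.
    apply: contra qUX => /eqP E; apply/eqP.
    by rewrite Uw [LHS]ract_cuspval ?E // ract_cuspval.
  + have := Kgood w Gw w0; rewrite /cuspgap normrM; apply.
    apply: contra v0 => /eqP E; rewrite cv -E /cuspval.
    by apply/eqP; field.
- rewrite YU; apply: (@le_trans _ _ (k * m)); first by rewrite /e ge_min lexx orbT.
  rewrite mulrA ler_pdivlMr // mulrAC mulrC.
  by apply: ler_pM; rewrite ?mulr_ge0 ?(ltW m0) // mP.
Qed.

(** Any cusp value F . oo can be followed by a cusp value G . oo with gap close
    to 1 / l.  The new endpoint X . oo may have an arbitrarily large denominator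
    in terms of that of G, which keeps the gap of G stable later on. *)
Lemma pass_near_cusp (R : realType) (Gam : set (SL2 R)) (P m k l eps T : R) (F : SL2 R) :
  dense_fuchsian Gam P m -> 0 <= k -> Gam F -> ec F != 0 -> 2 <= l -> 0 < eps -> 0 <= T ->
  exists G, [/\ Gam G, ec G != 0, T <= `|ec G| & forall T', exists X,
    [/\ Gam X, ec X != 0, T' <= `|ec X|, `|cuspgap G (cuspval X) - l^-1| <= eps &
        cuspgap F (cuspval X) <= 1 /\
        forall U, Gam U -> ec U != 0 -> k * `|ec F| <= `|ec U| ->
          cuspval U != cuspval G -> cuspval U != cuspval X ->
          gap_bound P m k <= cuspgap U (cuspval X)]].
Proof.
move=> dG kge0 GF f0 l2 e0 T0; have [fG m0 mP _] := dG; have P0 := fuch_width fG.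
pose d := Num.min (eps / 2) (1 / 2).
have d0 : 0 < d by rewrite lt_min !divr_gt0.
have de : d <= eps / 2 by rewrite ge_min lexx.
have d1 : d <= 1 / 2 by rewrite ge_min lexx orbT.
have Tm0 : 0 <= T / m by rewrite divr_ge0 // ltW.
have dV0 : 0 < d^-1 by rewrite invr_gt0.
have [K [gK cK pairK]] :=
  good_cusp_pair dG l (T / m + d^-1 + 1) d0.
have [GK k0 _] := gK.
have [s [A [GA KA Z2 ZP]]] : exists s A, [/\ Gam A, bridge s K A,
    2 <= turn s F K & turn s F K <= 2 + P].
  (* Multiples of P cover R, so the turn can be brought into [2, 2 + P]. *)
  pose z := ed K / ec K - ed F / ec F - 2.
  pose j := Num.floor (z / P).
  have [J GJ [Ja Jb Jc Jd]] := translations fG j.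
  exists (j%:~R * P), (J * K^-1)%g; split.
  - by apply: (fuchM fG) => //; exact: (fuchV fG).
  - by split; rewrite !entriesM ?Ja ?Jb ?Jc ?Jd; ring.
  - have : j%:~R <= z / P by exact: floor_le.
    by rewrite ler_pdivlMr // /turn /z; lra.
  - have : z / P < (j + 1)%:~R by exact: floorD1_gt.
    by rewrite ltr_pdivrMr // intrD mulrDl mul1r /turn /z; lra.
pose G := (F * A)%g; set Z := turn s F K in Z2 ZP.
have GG : Gam G by exact: (fuchM fG).
have cG : ec G = ec F * ec K * Z by exact: ec_bridge.
have Z0 : 0 < Z by clear -Z2; lra.
have g0 : ec G != 0 by rewrite cG !mulf_neq0 // gt_eqF.
have nK : 0 < `|ec K| by rewrite normr_gt0.
have nF : 0 < `|ec F| by rewrite normr_gt0.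
exists G; split => //.
  rewrite cG !normrM (gtr0_norm Z0).
  have hT : T <= m * `|ec K| by rewrite mulrC -ler_pdivrMr //; clear -cK dV0; lra.
  apply: le_trans hT _; rewrite -[leLHS]mulr1; apply: ler_pM => //.
  - by rewrite mulr_ge0 // ltW.
  - by rewrite ler_pM2r // mP.
  - by clear -Z2; lra.
move=> T'.
have [Xi [gX cX dX]] := pairK (`|T'| / (`|ec F| * `|ec K|)).
have [GX x0 _] := gX; set x := cuspval Xi in dX.
have u1 : 1 <= x - cuspval K.
  by move: dX; rewrite ltr_norml => /andP[dX1 _]; clear -dX1 d1 l2; lra.
have xK : x != cuspval K by rewrite -subr_eq0 gt_eqF // (lt_le_trans ltr01).
pose W := turn_at s F K x.
have WZ : `|W - Z| <= d.
  rewrite /W /turn_at addrC addKr ger0_norm; last first.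
    by rewrite invr_ge0 mulr_ge0 ?sqr_ge0 // (le_trans ler01).
  rewrite -[leRHS]invrK lef_pV2 ?posrE ?invr_gt0 //; last first.
    by rewrite mulr_gt0 ?exprn_even_gt0 // (lt_le_trans ltr01).
  have c1 : 1 <= `|ec K| by clear -cK dV0 Tm0; lra.
  have c2 : d^-1 <= `|ec K| by clear -cK Tm0; lra.
  rewrite -(real_normK (num_real (ec K))) expr2.
  apply: le_trans c2 _; rewrite -[leLHS]mulr1 -mulrA.
  by apply: ler_pM => //; rewrite -[leLHS]mulr1; apply: ler_pM.
have [W1 W2] : 3 / 2 <= W /\ W <= 3 + P.
  by move: WZ; rewrite ler_norml => /andP[h1 h2]; clear -h1 h2 d1 Z2 ZP; split; lra.
have W0 : 0 < W by clear -W1; lra.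
have denG := glued_den KA f0 k0 xK; rewrite -/G -/W in denG.
have denG0 : ec G * x + ed G != 0 by rewrite denG !mulf_neq0 ?subr_eq0 // gt_eqF.
have denA0 : ec A * x + ed A != 0.
  by rewrite (bridge_den KA k0) oppr_eq0 mulf_neq0 // subr_eq0.
have denF := base_den KA f0 k0 xK; rewrite -/W in denF.
have denF0 : ec F * ract A x + ed F != 0.
  by rewrite denF oppr_eq0 mulf_neq0 // gt_eqF.
pose X := (G * Xi)%g.
have qX : cuspval X = ract G x by rewrite /X ract_cuspval.
have cXE : ec X = ec Xi * (ec G * x + ed G).
  by rewrite /X ecM /x /cuspval; field.
have uW : 1 <= (x - cuspval K) * W.
  by rewrite -[leLHS]mulr1; apply: ler_pM => //; clear -W1; lra.
have uW0 : 0 < (x - cuspval K) * W by rewrite (lt_le_trans ltr01).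
have [e1 _ e2 _] := @SL2_entries1 R.
exists X; split=> //.
- exact: (fuchM fG).
- by rewrite cXE mulf_neq0.
- rewrite cXE denG -[_ * _ * (x - cuspval K) * W]mulrA 3!normrM (gtr0_norm uW0).
  move: cX; rewrite ler_pdivrMr ?mulr_gt0 // => /(le_trans (ler_norm T')) h.
  by apply: le_trans h _; rewrite ler_wpM2l // ler_peMr // mulr_ge0.
- have -> : cuspgap G (cuspval X) = Z / ((x - cuspval K) * W).
    have := cuspgap_ract 1%g denG0; rewrite mulg1 -qX e1 e2 mul0r sub0r normrN normr1 mulr1.
    move=> ->; rewrite denG cG -[_ * _ * (x - cuspval K) * W]mulrA normrM.
    by rewrite (normrM (ec F * ec K)) (gtr0_norm Z0) (gtr0_norm uW0) -mulf_div divff ?mul1r // normr_eq0 mulf_neq0.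
  apply: le_trans (ratio_close W1 WZ u1 _ l2) _; last by clear -de; lra.
  exact: ltW.
split; last first.
  by move=> U GU u0 kU qUG qUX; rewrite qX; apply: (glued_gap dG kge0 KA) => //; rewrite W0.
rewrite qX ract_comp //.
have := cuspgap_ract 1%g denF0; rewrite mulg1 e1 e2 mul0r sub0r normrN normr1 mulr1.
move=> ->; rewrite denF normrN normrM (gtr0_norm W0).
by rewrite invfM mulrA divff ?gt_eqF // mul1r invf_le1 //; clear -W1; lra.
Qed.

Lemma cuspgap_lipschitz (R : realType) (A : SL2 R) x y :
  cuspgap A x <= cuspgap A y + ec A ^+ 2 * `|x - y|.
Proof.
rewrite /cuspgap -[ec A ^+ 2]ger0_norm ?sqr_ge0 // -normrM.
have -> : ec A * (ec A * x - ea A) =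
  ec A * (ec A * y - ea A) + ec A ^+ 2 * (x - y) by ring.
exact: ler_normD.
Qed.

(** Iterate [pass_near_cusp] along X_0, X_1, ... with values converging to alpha.
    The steps are bounded by 1 / c_i ^ 2, where c_i, the denominator of X_i, at
    least doubles, so alpha is within 2 / c_i ^ 2 of the value of X_i.  A cusp
    value with denominator c is treated at the first i with c < k c_(i+1): there
    c >= k c_i, so its gap at X_(i+1) is bounded below, and going on to alpha
    changes the gap by at most 2 c ^ 2 / c_(i+1) ^ 2 <= 2 k ^ 2. *)
Lemma prescribed_gaps (R : realType) (Gam : set (SL2 R)) (P m : R) :
  dense_fuchsian Gam P m -> exists2 eta, 0 < eta &
  forall l : nat -> R, (forall i, 2 <= l i) -> exists alpha (S : nat -> SL2 R),
  [/\ forall i, Gam (S i) /\ ec (S i) != 0,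
      forall i, `|ec (S i)| < `|ec (S i.+1)|,
      forall i, `|cuspgap (S i) alpha - (l i)^-1| <= i.+1%:R^-1 &
      forall U, Gam U -> ec U != 0 ->
        (exists i, cuspval U = cuspval (S i)) \/ eta <= cuspgap U alpha].
Proof.
move=> dG; have [fG m0 mP dense] := dG; have P0 := fuch_width fG.
have [X0 [GX0 x0 _]] := dense 0 1 ltr01.
have nX0 : 0 < `|ec X0| by rewrite normr_gt0.
(* The bound m / |ec X0| makes k |ec X0| at most every denominator. *)
pose k := Num.min (Num.min 1 (m / `|ec X0|)) (Num.min (m / 80 / 80) (4 * (3 + P))^-1).
have [k1 k2 k3 k4] : [/\ k <= 1, k * `|ec X0| <= m, k <= m / 80 / 80 & k <= (4 * (3 + P))^-1].
  rewrite -ler_pdivlMr //.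
  by split; rewrite /k !ge_min lexx ?orbT.
have P3 : 0 < (4 * (3 + P))^-1 by rewrite invr_gt0 mulr_gt0 // addr_gt0.
have k0 : 0 < k.
  have h1 : 0 < m / 80 / 80 by rewrite !divr_gt0.
  have h2 := divr_gt0 m0 nX0.
  by rewrite lt_min; apply/andP; split; rewrite lt_min; apply/andP; split.
have kge0 := ltW k0.
have kk : k ^+ 2 <= k by rewrite expr2 ler_piMr.
pose b := gap_bound P m k.
have bk : 4 * k ^+ 2 <= b.
  have E3 : (4 * (3 + P))^-1 = (3 + P)^-1 / 4.
    by rewrite invfM mulrC.
  rewrite /b /gap_bound !le_min; apply/and3P; split.
  - by clear -kk k3; lra.
  - have : k * k <= k * (m / 80 / 80) by rewrite ler_pM2l.
    by rewrite expr2; have := mulr_gt0 k0 m0; clear; lra.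
  - by clear -kk k4 E3; lra.
have b0 : 0 < b.
  by rewrite /b /gap_bound 2!lt_min (divr_gt0 (mulr_gt0 k0 m0)) // !divr_gt0 // invr_gt0 addr_gt0.
exists (b / 2); first by rewrite divr_gt0.
move=> l l2.
pose ok X := Gam X /\ ec X != 0.
pose link i F (GX : SL2 R * SL2 R) := ok F -> [/\ ok GX.1, ok GX.2,
  `|ec F| + 1 <= `|ec GX.1|,
  2 * `|ec F| + 4 * i.+1%:R * `|ec GX.1| <= `|ec GX.2| &
  [/\ `|cuspgap GX.1 (cuspval GX.2) - (l i)^-1| <= (2 * i.+1%:R)^-1,
      cuspgap F (cuspval GX.2) <= 1 &
      forall U, Gam U -> ec U != 0 -> k * `|ec F| <= `|ec U| ->
        cuspval U != cuspval GX.1 -> cuspval U != cuspval GX.2 ->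
        b <= cuspgap U (cuspval GX.2)]].
have step i F : exists GX, link i F GX.
  have [[GF f0]|nF] := pselect (ok F); last by exists (F, F).
  have e0 : 0 < (2 * i.+1%:R : R)^-1 by rewrite invr_gt0 mulr_gt0 // ltr0n.
  have T0 : 0 <= `|ec F| + 1 by rewrite addr_ge0.
  have [G [GG g0 cG next]] := pass_near_cusp dG kge0 GF f0 (l2 i) e0 T0.
  have [X [GX x1 cX gX [gF far]]] := next (2 * `|ec F| + 4 * i.+1%:R * `|ec G|).
  by exists (G, X).
pose next i F := sval (cid (step i F)).
pose X := fix X n := if n is n'.+1 then (next n' (X n')).2 else X0.
pose S i := (next i (X i)).1.
have XSE i : X i.+1 = (next i (X i)).2 by [].
have linkP i : link i (X i) (next i (X i)) by exact: (svalP (cid (step i (X i)))).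
have okX i : ok (X i).
  by elim: i => [//|i IH]; have [_ + _ _ _] := linkP i IH.
have okS i : ok (S i) by have [+ _ _ _ _] := linkP i (okX i).
have cXS i : `|ec (X i)| + 1 <= `|ec (S i)| by have [_ _ + _ _] := linkP i (okX i).
have cSX i : 2 * `|ec (X i)| + 4 * i.+1%:R * `|ec (S i)| <= `|ec (X i.+1)|.
  by have [_ _ _ + _] := linkP i (okX i).
have i1 i : 1 <= i.+1%:R :> R by rewrite ler1n.
have cS_le i : 4 * i.+1%:R * `|ec (S i)| <= `|ec (X i.+1)|.
  by have := cSX i; have := normr_ge0 (ec (X i)); clear; lra.
have cS_le1 i : `|ec (S i)| <= `|ec (X i.+1)|.
  apply: le_trans (cS_le i); rewrite ler_peMl //.
  by have := i1 i; clear; lra.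
have cX_le i : 2 * `|ec (X i)| <= `|ec (X i.+1)|.
  apply: le_trans (cSX i); rewrite lerDl mulr_ge0 // mulr_ge0 //.
have cpos i : 0 < `|ec (X i)| by rewrite normr_gt0; case: (okX i).
have c2pos i : 0 < ec (X i) ^+ 2 by rewrite exprn_even_gt0 //; case: (okX i).
pose r i := 2 / ec (X i) ^+ 2.
have r0 i : 0 <= r i by rewrite divr_ge0 // ltW.
have rS i : r i.+1 <= r i / 4.
  rewrite /r -mulrA -invfM ler_pM2l // lef_pV2 ?posrE ?c2pos ?(mulr_gt0 (c2pos _)) //.
  rewrite -[ec (X i) ^+ 2](real_normK (num_real _)) -[ec (X i.+1) ^+ 2](real_normK (num_real _)).
  have -> : `|ec (X i)| ^+ 2 * 4 = (2 * `|ec (X i)|) ^+ 2 by ring.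
  by rewrite ler_sqr ?nnegrE ?mulr_ge0.
have Xr i : `|cuspval (X i.+1) - cuspval (X i)| <= r i - r i.+1.
  have [_ _ _ _ [_ h _]] := linkP i (okX i).
  rewrite cuspgapE in h; last by case: (okX i).
  rewrite -XSE mulrC -ler_pdivlMr // in h.
  by have := rS i; have := r0 i; move: h; rewrite /r; clear; lra.
have [alpha aP] := nested_balls Xr r0.
exists alpha, S; split=> //.
- by move=> i; have := cS_le1 i; have := cXS i.+1; clear; lra.
- move=> i; have [_ _ _ _ [g1 _ _]] := linkP i (okX i).
  rewrite -/(S i) -XSE in g1.
  have move1 : ec (S i) ^+ 2 * `|alpha - cuspval (X i.+1)| <= (2 * i.+1%:R)^-1.
    apply: le_trans (ler_wpM2l (sqr_ge0 _) (aP i.+1)) _.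
    rewrite /r mulrA ler_pdivrMr // mulrC ler_pdivlMl ?mulr_gt0 ?ltr0n //.
    rewrite -[ec (S i) ^+ 2](real_normK (num_real _)) -[ec (X i.+1) ^+ 2](real_normK (num_real _)).
    apply: (@le_trans _ _ ((4 * i.+1%:R * `|ec (S i)|) ^+ 2)); last first.
      by rewrite ler_sqr ?nnegrE ?mulr_ge0.
    have -> : (4 * i.+1%:R * `|ec (S i)|) ^+ 2 =
        16 * i.+1%:R * (i.+1%:R * `|ec (S i)| ^+ 2) by ring.
    have -> : 2 * i.+1%:R * (2 * `|ec (S i)| ^+ 2) =
        4 * (i.+1%:R * `|ec (S i)| ^+ 2) by ring.
    have s0 : 0 <= i.+1%:R * `|ec (S i)| ^+ 2 by rewrite mulr_ge0 ?sqr_ge0.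
    by rewrite ler_wpM2r //; have := i1 i; clear; lra.
  have L1 := cuspgap_lipschitz (S i) alpha (cuspval (X i.+1)).
  have L2 := cuspgap_lipschitz (S i) (cuspval (X i.+1)) alpha.
  rewrite distrC in L2.
  have E : i.+1%:R^-1 = (2 * i.+1%:R)^-1 + (2 * i.+1%:R)^-1 :> R.
    by field; rewrite addrC natr1 pnatr_eq0.
  move: g1; rewrite E !ler_norml => /andP[g1 g2]; move: g1 g2 L1 L2 move1.
  move: (2 * i.+1%:R)^-1 (ec (S i) ^+ 2 * _) => h u; clear => g1 g2 L1 L2 uh.
  by apply/andP; split; lra.
- move=> U GU u0.
  have large i : i%:R <= `|ec (X i)|.
    elim: i => [//|i IH]; rewrite -natr1.
    by have := cS_le1 i; have := cXS i; clear -IH; lra.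
  have ex : exists n, `|ec U| < k * `|ec (X n)|.
    exists (Num.truncn (`|ec U| / k)).+1; rewrite mulrC -ltr_pdivrMr //.
    exact: lt_le_trans (truncnS_gt _) (large _).
  case: (ex_minnP ex) => n nP nmin.
  case: n nP nmin => [|i] nP nmin.
    by move: nP; rewrite ltNge (le_trans k2) // mP.
  have kU : k * `|ec (X i)| <= `|ec U|.
    by rewrite leNgt; apply/negP => /nmin; rewrite ltnn.
  have [|qS] := eqVneq (cuspval U) (cuspval (S i)); first by left; exists i.
  right; have [_ _ _ _ [_ _ far]] := linkP i (okX i).
  have qX : cuspval U != cuspval (X i.+1).
    apply/eqP => E; move: nP; have [GX x1] := okX i.+1.
    by rewrite (cuspval_eq fG GU GX u0 x1 E) ltNge ler_piMl.
  have {}far := far U GU u0 kU qS qX; rewrite -XSE in far.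
  have L2 := cuspgap_lipschitz U (cuspval (X i.+1)) alpha.
  rewrite distrC in L2.
  have : ec U ^+ 2 * `|alpha - cuspval (X i.+1)| <= 2 * k ^+ 2.
    apply: le_trans (ler_wpM2l (sqr_ge0 _) (aP i.+1)) _.
    rewrite /r mulrA ler_pdivrMr // mulrC -mulrA ler_pM2l //.
    rewrite -[ec U ^+ 2](real_normK (num_real _)) -[ec (X i.+1) ^+ 2](real_normK (num_real _)).
    by rewrite -exprMn ler_sqr ?nnegrE ?mulr_ge0 // ltW.
  by clear -far L2 bk; lra.
Qed.

(** * Hyperbolic area in logarithmic coordinates *)

Section IntegralDensity.
Local Open Scope ereal_scope.
Context d (X : measurableType d) d' (Y : measurableType d') (R : realType).
Context (mu : {measure set X -> \bar R}) (nu : {measure set Y -> \bar R}).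
Context (phi : X -> Y) (mphi : measurable_fun setT phi).
Context (w : X -> R) (mw : measurable_fun setT w) (w0 : forall x, (0 <= w x)%R).
Hypothesis nuE : forall B, measurable B -> nu B = \int[mu]_(x in phi @^-1` B) (w x)%:E.

Import HBNNSimple.

(** Integration against the measure with density w, transported by phi.  True by
    hypothesis for indicator functions, and extended by simple functions and
    monotone convergence. *)
Lemma ge0_integral_density (f : Y -> \bar R) : measurable_fun setT f ->
  (forall y, 0 <= f y) -> \int[nu]_y f y = \int[mu]_x (f (phi x) * (w x)%:E).
Proof.
move=> mf f0; pose h := nnsfun_approx measurableT mf.
have mwE : measurable_fun setT (EFin \o w) by exact/measurable_EFinP.
have hcvg y : (EFin \o h n) y @[n --> \oo] --> f y by exact: cvg_nnsfun_approx.
transitivity (lim (\int[nu]_y (h n y)%:E @[n --> \oo])).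
  rewrite -monotone_convergence//.
  - by apply: eq_integral => y _; apply/esym/cvg_lim => //; exact: hcvg.
  - by move=> n; exact/measurable_EFinP/measurable_funP.
  - by move=> n y _; rewrite lee_fin.
  - by move=> y _ a b ab; rewrite lee_fin; exact/lefP/nd_nnsfun_approx.
transitivity (lim (\int[mu]_x ((h n (phi x))%:E * (w x)%:E) @[n --> \oo])); last first.
  rewrite -monotone_convergence//.
  - apply: eq_integral => x _; apply/cvg_lim => //.
    by apply: cvgeZr => //; exact: hcvg.
  - move=> n; apply: emeasurable_funM => //; apply/measurable_EFinP.
    exact: measurableT_comp.
  - by move=> n x _; rewrite mule_ge0 // lee_fin.
  - move=> x _ a b ab; rewrite lee_wpmul2r ?lee_fin //.
    exact/lefP/nd_nnsfun_approx.
suff suf n : \int[nu]_y (h n y)%:E = \int[mu]_x ((h n (phi x))%:E * (w x)%:E).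
  by under eq_fun do rewrite suf.
have mpre r : measurable (h n @^-1` [set r]) by [].
have indich r : measurable_fun setT (fun y => (r * \1_(h n @^-1` [set r]) y)%:E).
  by apply/measurable_EFinP; exact: measurable_funM.
transitivity (\int[nu]_y
   (\sum_(r \in range (h n)) (r * \1_(h n @^-1` [set r]) y)%:E)).
  by apply: eq_integral => t tE; rewrite /= fimfunE -fsumEFin.
rewrite ge0_integral_fsum//; last by move=> r y _; exact: nnfun_muleindic_ge0.
transitivity (\int[mu]_x (\sum_(r \in range (h n))
    (r * \1_(h n @^-1` [set r]) (phi x))%:E * (w x)%:E)); last first.
  apply: eq_integral => x _; rewrite -ge0_mule_fsuml => [|r].
    by rewrite fsumEFin // -(fimfunE _ (phi x)).
  exact: (nnfun_muleindic_ge0 (h n) r (phi x)).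
rewrite ge0_integral_fsum//; last 2 first.
- move=> r; apply: emeasurable_funM => //.
  exact: (measurableT_comp (indich r) mphi).
- by move=> r x _; rewrite mule_ge0 ?lee_fin//; exact: (nnfun_muleindic_ge0 (h n) r (phi x)).
apply: eq_fsbigr => r rhn.
under eq_integral do rewrite EFinM.
rewrite integralZl_indic_nnsfun // integral_indic // setIT nuE //.
have r0 : (0 <= r)%R by move: rhn => /set_mem[y _ <-].
under [RHS]eq_integral do rewrite EFinM -muleA.
rewrite ge0_integralZl//.
- congr (_ * _); rewrite integral_mkcond; apply: eq_integral => x _.
  rewrite patchE indicE; case: (boolP (x \in _)) => hx.
    by rewrite mem_set ?mul1e //; move: hx => /set_mem.
  by rewrite memNset ?mul0e // => hx'; move: hx; rewrite mem_set.
- apply: emeasurable_funM => //; apply/measurable_EFinP.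
  by apply: measurableT_comp => //; exact: measurable_indic.
- by move=> x _; rewrite mule_ge0 ?lee_fin.
Qed.

End IntegralDensity.

Section LogDensity.
Context {R : realType}.
Local Notation lam := (@lebesgue_measure R).

Definition inv_pos (y : R) : R := if 0 < y then y^-1 else 0.

Lemma inv_pos_ge0 y : 0 <= inv_pos y.
Proof. by rewrite /inv_pos; case: ifPn => // y0; rewrite invr_ge0 ltW. Qed.

Lemma measurable_inv_pos : measurable_fun setT inv_pos.
Proof.
have -> : inv_pos = fun y => if 0 < y then expR (- ln y) else 0.
  apply/funext => y; rewrite /inv_pos; case: ifPn => // y0.
  by rewrite expRN lnK.
apply: measurable_fun_ifT.
- by apply: measurable_fun_ltr => //; exact: measurable_cst.
- by do 2 apply: measurableT_comp => //; exact: measurable_ln.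
- exact: measurable_cst.
Qed.

Lemma integral_inv_itv (a b : R) : 0 < a -> a < b ->
  (\int[lam]_(y in `]a, b]) (y^-1)%:E = (ln b - ln a)%:E)%E.
Proof.
move=> a0 ab.
have cinv : {within `[a, b], continuous (fun y : R => y^-1)}.
  apply: continuous_in_subspaceT => y; rewrite inE/= in_itv/= => /andP[ay _].
  by apply: inv_continuous; rewrite gt_eqF // (lt_le_trans a0).
rewrite integral_itv_obnd_cbnd; last first.
  apply/measurable_EFinP; apply: (measurable_funS (E := `[a, b]%classic)) => //.
    exact: subset_itv_oc_cc.
  exact: subspace_continuous_measurable_fun.
rewrite (@continuous_FTC2 _ _ (@ln R)) //.
- split.
  + move=> y; rewrite in_itv/= => /andP[ay _].
    by apply: ex_derive; apply: is_derive1_ln; exact: lt_trans ay.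
  + by apply: cvg_at_right_filter; exact: continuous_ln.
  + by apply: cvg_at_left_filter; apply: continuous_ln; exact: lt_trans ab.
- move=> y; rewrite in_itv/= => /andP[ay _].
  by rewrite derive1E; apply: derive_val; apply: is_derive1_ln; exact: lt_trans ay.
Qed.

(** The measure dy / y on the positive reals, transported by the logarithm. *)
Definition ln_measure (B : set (measurableTypeR R)) : \bar R :=
  (\int[lam]_(y in (@ln R) @^-1` B) (inv_pos y)%:E)%E.

Let mln (B : set R) : measurable B -> measurable ((@ln R) @^-1` B).
Proof. by move=> mB; rewrite -[X in measurable X]setTI; exact: measurable_ln. Qed.

Let ln_measure0 : ln_measure set0 = 0%E.
Proof. by rewrite /ln_measure preimage_set0 integral_set0. Qed.

Let ln_measure_ge0 B : (0 <= ln_measure B)%E.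
Proof. by apply: integral_ge0 => y _; rewrite lee_fin inv_pos_ge0. Qed.

Let ln_measure_sigma_additive : semi_sigma_additive ln_measure.
Proof.
move=> F mF tF mUF; rewrite /ln_measure; apply: cvg_toP.
  apply: ereal_nondecreasing_is_cvgn => m n mn.
  apply: lee_sum_nneg_natr => // k _ _; exact: ln_measure_ge0.
rewrite preimage_bigcup ge0_integral_bigcup//=.
- by move=> k; exact: (mln (mF k)).
- by apply: measurable_funTS; apply/measurable_EFinP; exact: measurable_inv_pos.
- by move=> y _; rewrite lee_fin inv_pos_ge0.
- by apply/trivIsetP => i j _ _ ij; rewrite -preimage_setI; move/trivIsetP : tF => ->; rewrite ?preimage_set0.
Qed.

HB.instance Definition _ := isMeasure.Build _ (measurableTypeR R) R ln_measure
  ln_measure0 ln_measure_ge0 ln_measure_sigma_additive.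

(** Both measures give b - a to the interval from a to b. *)
Lemma ln_measureE (B : set R) : measurable B -> lam B = ln_measure B.
Proof.
move=> mB; apply: (@lebesgue_measure_unique _ ln_measure) => //= _ [[a b] _ <-] /=.
rewrite lebesgue_measure_itv /= lte_fin.
case: ifPn => ab; last first.
  rewrite set_itv_ge ?bnd_simp // preimage_set0 integral_set0 //.
rewrite /ln_measure integral_mkcond.
transitivity (\int[lam]_y (((fun y => (y^-1)%:E) \_ `]expR a, expR b]) y)%E)%E.
  rewrite -integral_mkcond integral_inv_itv ?expR_gt0 ?ltr_expR // !expRK //.
apply: eq_integral => y _; rewrite !patchE /inv_pos.
have [y0|y0] := ltP 0 y; last first.
  rewrite memNset; first by case: ifPn.
  by rewrite /= in_itv /= => /andP[h _]; have := expR_gt0 a; rewrite ltNge (le_trans (ltW h)).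
have E : (y \in `]expR a, expR b]%classic) = (y \in (@ln R) @^-1` `]a, b]%classic).
  have [z ->] : exists z, y = expR z by exists (ln y); rewrite lnK.
  by apply/idP/idP; rewrite !inE /= !in_itv /= expRK ltr_expR ler_expR.
by rewrite E.
Qed.

Lemma ge0_integral_expR (h : R -> \bar R) : measurable_fun setT h ->
  (forall y, 0 <= h y)%E ->
  (\int[lam]_t h (expR t) = \int[lam]_y (h y * (inv_pos y)%:E))%E.
Proof.
move=> mh h0.
rewrite (@ge0_integral_density _ (measurableTypeR R) _ (measurableTypeR R) R lam lam
  (@ln R) (@measurable_ln R) inv_pos measurable_inv_pos inv_pos_ge0 _
  (fun t => h (expR t))) //.
- apply: eq_integral => y _; rewrite /inv_pos; case: ifPn => y0.
    by rewrite lnK.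
  by rewrite !mule0.
- by move=> B mB; exact: ln_measureE.
- by apply: measurableT_comp => //; exact: measurable_expR.
Qed.

End LogDensity.

Section Plane.
Context {R : realType}.
Local Notation lam := (@lebesgue_measure R).
Local Notation plane := (measurableTypeR R * measurableTypeR R)%type.
Local Notation mu2 := (lam \x lam)%E.

Lemma lebesgue_translation (c : R) (B : set R) : measurable B ->
  lam ((fun x => x + c) @^-1` B) = lam B.
Proof.
move=> mB; have mc : measurable_fun setT (fun x : R => x + c).
  by apply: measurable_funD => //; exact: measurable_cst.
apply/esym; apply: (@lebesgue_measure_unique _
  (pushforward lam (fun x : measurableTypeR R => x + c : measurableTypeR R))) => //= _ [[a b] _ <-] /=.
rewrite /pushforward.
have -> : (fun x => x + c) @^-1` `]a, b]%classic = `](a - c), (b - c)]%classic.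
  by apply/seteqP; split => x /=; rewrite !in_itv /= ltrBlDr lerBrDr.
by rewrite !lebesgue_measure_itv /= !lte_fin ltrD2r -!EFinB opprB addrA subrK.
Qed.

Lemma lebesgue_scale (k : R) (B : set R) : 0 < k -> measurable B ->
  lam ((fun x => k * x) @^-1` B) = (k^-1%:E * lam B)%E.
Proof.
move=> k0 mB; have mk : measurable_fun setT (fun x : R => k * x).
  by apply: measurable_funM => //; exact: measurable_cst.
pose kn := NngNum (ltW k0).
have E : lam B = (k%:E * lam ((fun x => k * x)%R @^-1` B))%E.
  apply: (@lebesgue_measure_unique _
    (mscale kn (pushforward lam (fun x : measurableTypeR R => (k * x)%R : measurableTypeR R)))) => //= _ [[a b] _ <-] /=.
  rewrite /mscale /pushforward.
  rewrite [X in (_ * lebesgue_measure X)%E](_ : _ = `](a / k), (b / k)]%classic); last first.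
    by apply/seteqP; split => x /=; rewrite !in_itv /= ltr_pdivrMr // ler_pdivlMr // (mulrC x).
  rewrite !lebesgue_measure_itv /= !lte_fin ltr_pM2r ?invr_gt0 //.
  case: ifPn => _; last by rewrite mule0.
  by rewrite -!EFinB -EFinM; congr (_%:E); field; rewrite gt_eqF.
by rewrite E muleA -EFinM mulVf ?gt_eqF // mul1e.
Qed.

Lemma mu2_y (A : set plane) : measurable A ->
  mu2 A = (\int[lam]_y lam (ysection A y))%E.
Proof.
move=> mA; rewrite (@product_measure_unique _ _ _ _ _ lam lam (lam \x^ lam)%E) //=.
by move=> X Y mX mY; rewrite product_measure2E.
Qed.


(** Measure preserving maps of the plane; by the definition of the product
    measure through sections it suffices to look at one coordinate at a time. *)
Definition preserves (phi : plane -> plane) := measurable_fun setT phi /\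
  forall A, measurable A -> mu2 (phi @^-1` A) = mu2 A.

Lemma preserves_comp phi psi : preserves phi -> preserves psi ->
  preserves (phi \o psi).
Proof.
move=> [mphi phiE] [mpsi psiE]; split; first exact: measurableT_comp.
move=> A mA; rewrite comp_preimage psiE ?phiE //.
by rewrite -[X in measurable X]setTI; exact: mphi.
Qed.

Lemma preserves_vertical (psi : R -> R -> R) :
  measurable_fun setT (fun p : plane => psi p.1 p.2) ->
  (forall s B, measurable B -> lam (psi s @^-1` B) = lam B) ->
  preserves (fun p => (p.1, psi p.1 p.2)).
Proof.
move=> mpsi psiE; split; first exact: measurable_fun_pair.
move=> A mA; rewrite /product_measure1 /=; apply: eq_integral => s _ /=.
rewrite -(psiE s (xsection A s)); last exact: measurable_xsection.
by rewrite !xsectionE.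
Qed.

Lemma preserves_horizontal (psi : R -> R -> R) :
  measurable_fun setT (fun p : plane => psi p.1 p.2) ->
  (forall t B, measurable B -> lam (psi ^~ t @^-1` B) = lam B) ->
  preserves (fun p => (psi p.1 p.2, p.2)).
Proof.
move=> mpsi psiE.
have mphi : measurable_fun setT (fun p : plane => (psi p.1 p.2, p.2) : plane).
  exact: measurable_fun_pair.
split => // A mA; rewrite !mu2_y //; last first.
  by rewrite -[X in measurable X]setTI; exact: mphi.
apply: eq_integral => t _ /=.
rewrite -(psiE t (ysection A t)); last exact: measurable_ysection.
by rewrite !ysectionE.
Qed.

(** From the coordinates s = x / y and t = ln y back to (x, y). *)
Definition of_log (p : plane) : plane := (expR p.2 * p.1, expR p.2).

Lemma measurable_of_log : measurable_fun setT of_log.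
Proof.
have m2 : measurable_fun setT (fun p : plane => expR p.2).
  by apply: measurableT_comp => //; exact: measurable_expR.
by apply: measurable_fun_pair => //; exact: measurable_funM.
Qed.

(** The substitutions x = y s, for fixed y, and y = e^t, whose Jacobians y and y
    cancel the density of the hyperbolic area. *)
Lemma area_of_log (F : set plane) : measurable F -> (forall p, F p -> 0 < p.2) ->
  mu2 (of_log @^-1` F) = (\int[mu2]_(p in F) (p.2 ^- 2)%:E)%E.
Proof.
move=> mF F0.
have mlF : measurable (of_log @^-1` F).
  by rewrite -[X in measurable X]setTI; exact: measurable_of_log.
pose h (y : R) : \bar R := ((inv_pos y)%:E * lam (ysection F y))%E.
have h0 y : (0 <= h y)%E by rewrite mule_ge0 // lee_fin inv_pos_ge0.
have mh : measurable_fun setT h.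
  apply: emeasurable_funM; first by apply/measurable_EFinP; exact: measurable_inv_pos.
  exact: measurable_fun_ysection.
transitivity (\int[lam]_t h (expR t))%E.
  rewrite mu2_y //; apply: eq_integral => t _.
  rewrite /h /inv_pos expR_gt0.
  rewrite -(lebesgue_scale (expR_gt0 t) (measurable_ysection (expR t) mF)).
  by rewrite !ysectionE.
rewrite ge0_integral_expR // [RHS]integral_mkcond.
have mf : measurable_fun [set: plane] ((fun p : plane => (p.2 ^- 2)%:E) \_ F).
  have -> : (fun p : plane => (p.2 ^- 2)%:E) \_ F =
      (fun p : plane => (inv_pos p.2 * inv_pos p.2)%:E) \_ F.
    apply/funext => p; rewrite !patchE; case: ifPn => // /set_mem /F0 p0.
    by rewrite /inv_pos p0 -invfM.
  apply/measurable_restrict => //; apply: measurable_funTS; apply/measurable_EFinP.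
  by apply: measurable_funM; apply: measurableT_comp => //; exact: measurable_inv_pos.
have f0 p : (0 <= ((fun p : plane => (p.2 ^- 2)%:E) \_ F) p)%E.
  by rewrite patchE; case: ifP => // _; rewrite lee_fin invr_ge0 exprn_even_ge0.
rewrite fubini_tonelli2 //; apply: eq_integral => y _; rewrite /fubini_G /h.
transitivity (\int[lam]_x ((fun=> (y ^- 2)%:E) \_ (ysection F y)) x)%E; last first.
  by apply: eq_integral => x _; rewrite !patchE mem_ysection.
rewrite -integral_mkcond integral_cst //; last exact: measurable_ysection.
have [y0|y0] := ltP 0 y.
  by rewrite muleC muleA -EFinM /inv_pos y0 -invfM.
have -> : ysection F y = set0.
  by apply/seteqP; split => x // /ysectionP /F0 /=; rewrite ltNge y0.
by rewrite !measure0 !mule0 mul0e.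
Qed.

End Plane.

Section Mobius.
Context {R : realType}.
Local Notation plane := (measurableTypeR R * measurableTypeR R)%type.
Implicit Types (A B : SL2 R) (p : R * R).

(** The Moebius action on pairs of real coordinates of the upper half-plane:
    [mob_den] is |c z + d| ^ 2. *)
Definition mob_den A p : R := (ec A * p.1 + ed A) ^+ 2 + (ec A * p.2) ^+ 2.
Definition mob_num A p : R :=
  (ea A * p.1 + eb A) * (ec A * p.1 + ed A) + ea A * ec A * p.2 ^+ 2.
Definition mob A p : R * R := (mob_num A p / mob_den A p, p.2 / mob_den A p).

Lemma mob_den_gt0 A p : 0 < p.2 -> 0 < mob_den A p.
Proof.
move=> y0; rewrite /mob_den lt_def addr_ge0 ?sqr_ge0 // andbT paddr_eq0 ?sqr_ge0 //.
rewrite !sqrf_eq0; apply/negP => /andP[/eqP h1].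
rewrite mulf_eq0 (gt_eqF y0) orbF => /eqP h2; have := SL2_detE A.
move: h1; rewrite h2 mul0r add0r => ->.
by rewrite !mulr0 subr0 => /eqP; rewrite eq_sym oner_eq0.
Qed.

Lemma mobM A B p : 0 < p.2 -> mob (A * B)%g p = mob A (mob B p).
Proof.
move=> y0; have N0 := lt0r_neq0 (mob_den_gt0 B y0).
have D := SL2_detE B.
have eN : mob_den A (mob B p) = mob_den (A * B)%g p / mob_den B p.
  have -> : mob_den A (mob B p) = ((ec A * mob_num B p + ed A * mob_den B p) ^+ 2 +
     (ec A * (1 * p.2)) ^+ 2) / mob_den B p / mob_den B p.
    by rewrite /mob {1}/mob_den /=; move: (mob_den B p) N0 => N N0; field.
  congr (_ / _); apply: (mulIf N0); rewrite divfK // -D.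
  by rewrite /mob_num /mob_den !entriesM; ring.
have eX : mob_num A (mob B p) = mob_num (A * B)%g p / mob_den B p.
  have -> : mob_num A (mob B p) = ((ea A * mob_num B p + eb A * mob_den B p) *
     (ec A * mob_num B p + ed A * mob_den B p) +
     ea A * ec A * (1 * p.2) ^+ 2) / mob_den B p / mob_den B p.
    by rewrite /mob {1}/mob_num /=; move: (mob_den B p) N0 => N N0; field.
  congr (_ / _); apply: (mulIf N0); rewrite divfK // -D.
  by rewrite /mob_num /mob_den !entriesM; ring.
have M0 := lt0r_neq0 (mob_den_gt0 (A * B)%g y0).
rewrite {1}/mob [RHS]/mob eN eX /=; congr (_, _).
  by move: (mob_den B p) (mob_den _ p) (mob_num _ p) N0 M0 => N M X N0 M0; field; rewrite N0 M0.
by move: (mob_den B p) (mob_den _ p) N0 M0 => N M N0 M0; field; rewrite N0 M0.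
Qed.

Lemma mob1 p : mob 1%g p = p.
Proof.
have [a b c d] := @SL2_entries1 R.
by case: p => x y; rewrite /mob /mob_num /mob_den a b c d /=; congr (_, _); field.
Qed.

Lemma mob_gt0 A p : 0 < p.2 -> 0 < (mob A p).2.
Proof. by move=> y0; rewrite divr_gt0 // mob_den_gt0. Qed.

Definition to_log p : plane := (p.1 / p.2, ln p.2).

Lemma of_logK : cancel (@of_log R) to_log.
Proof.
move=> [s t]; rewrite /to_log /of_log /= expRK; congr (_, _).
by field; rewrite gt_eqF // expR_gt0.
Qed.

Lemma to_logK p : 0 < p.2 -> of_log (to_log p) = p.
Proof.
case: p => x y /= y0; rewrite /to_log /of_log /= lnK //; congr (_, _).
by field; rewrite gt_eqF.
Qed.

Definition log_mob A (p : plane) : plane := to_log (mob A (of_log p)).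

Lemma of_log_gt0 p : 0 < (of_log p).2.
Proof. exact: expR_gt0. Qed.

Lemma log_mobM A B p : log_mob (A * B)%g p = log_mob A (log_mob B p).
Proof.
rewrite /log_mob to_logK ?mobM //; first exact: of_log_gt0.
exact/mob_gt0/of_log_gt0.
Qed.

Lemma log_mob1 p : log_mob 1%g p = p.
Proof. by rewrite /log_mob mob1 of_logK. Qed.

Definition log_shift (u : R) (p : plane) : plane := (p.1 + u * expR (- p.2), p.2).
Definition log_dilate (k : R) (p : plane) : plane := (p.1, p.2 + k).
Definition log_inv (p : plane) : plane := (- p.1, - (p.2 + ln (1 + p.1 ^+ 2))).

Lemma preserves_shift u : preserves (log_shift u).
Proof.
apply: (@preserves_horizontal R (fun s t => s + u * expR (- t))).
  apply: measurable_funD => //; apply: measurable_funM; first exact: measurable_cst.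
  apply: measurableT_comp; first exact: measurable_expR.
  by apply: measurableT_comp.
by move=> t B mB; exact: lebesgue_translation.
Qed.

Lemma preserves_dilate k : preserves (log_dilate k).
Proof.
apply: (@preserves_vertical R (fun s t => t + k)).
  by apply: measurable_funD => //; exact: measurable_cst.
by move=> t B mB; exact: lebesgue_translation.
Qed.

Lemma preserves_inv : preserves log_inv.
Proof.
have mopp (B : set (measurableTypeR R)) : measurable B ->
    measurable ((-%R : measurableTypeR R -> measurableTypeR R) @^-1` B).
  by move=> mB; rewrite -[X in measurable X]setTI; exact: oppr_measurable.
have h : preserves (fun p : plane => (- p.1, p.2) : plane).
  apply: (@preserves_horizontal R (fun s t => - s)); first exact: measurableT_comp.
  by move=> t B mB; exact: lebesgue_measureN.
apply: (@preserves_comp _ _ (fun p : plane => (p.1, - (p.2 + ln (1 + p.1 ^+ 2))) : plane) h).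
apply: (@preserves_vertical R (fun s t => - (t + ln (1 + s ^+ 2)))).
  apply: measurableT_comp => //; apply: measurable_funD => //.
  apply: measurableT_comp; first exact: measurable_ln.
  apply: measurable_funD; first exact: measurable_cst.
  by apply: measurable_funX.
move=> s B mB; rewrite -[RHS](lebesgue_measureN mB).
by rewrite -[RHS](lebesgue_translation (ln (1 + s ^+ 2)) (mopp B mB)).
Qed.

Lemma of_log_shift u p : of_log (log_shift u p) = ((of_log p).1 + u, (of_log p).2).
Proof.
rewrite /of_log /log_shift /= expRN; congr (_, _).
by field; rewrite gt_eqF // expR_gt0.
Qed.

Lemma of_log_dilate k p :
  of_log (log_dilate k p) = (expR k * (of_log p).1, expR k * (of_log p).2).
Proof. by rewrite /of_log /log_dilate /= expRD; congr (_, _); ring. Qed.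

Lemma of_log_inv p : of_log (log_inv p) =
  (- (of_log p).1 / ((of_log p).1 ^+ 2 + (of_log p).2 ^+ 2),
   (of_log p).2 / ((of_log p).1 ^+ 2 + (of_log p).2 ^+ 2)).
Proof.
case: p => s t; rewrite /of_log /log_inv /= expRN expRD lnK; last first.
  by rewrite posrE ltr_wpDr ?sqr_ge0.
have e0 : expR t != 0 by rewrite gt_eqF // expR_gt0.
have s0 : 1 + s ^+ 2 != 0 by rewrite gt_eqF // ltr_wpDr ?sqr_ge0.
move: (expR t) e0 => e e0.
have -> : (e * s) ^+ 2 + e ^+ 2 = e ^+ 2 * (1 + s ^+ 2) by ring.
by congr (_, _); field; rewrite e0 s0.
Qed.

(** For c <> 0, A z = a / c - c ^ -2 / (z + d / c) is a composition of two shifts,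
    a dilation and the inversion; for c = 0 a dilation and a shift suffice. *)
Lemma preserves_log_mob A : preserves (log_mob A).
Proof.
have [c0|c0] := eqVneq (ec A) 0.
  have D := SL2_detE A; rewrite c0 mulr0 subr0 in D.
  have d0 : ed A != 0 by apply/eqP => d0; move: D; rewrite d0 mulr0 => /eqP; rewrite eq_sym oner_eq0.
  have aE : ea A = (ed A)^-1 by apply: (mulIf d0); rewrite D mulVf.
  have -> : log_mob A = log_shift (ea A * eb A) \o log_dilate (ln ((ed A) ^- 2)).
    apply/funext => p; rewrite /= -[RHS]of_logK of_log_shift of_log_dilate lnK; last first.
      by rewrite posrE invr_gt0 exprn_even_gt0.
    rewrite /log_mob; congr to_log; rewrite /mob /mob_num /mob_den c0 aE /=.
    by congr (_, _); field; exact: d0.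
  by apply: preserves_comp; [exact: preserves_shift|exact: preserves_dilate].
have -> : log_mob A = log_shift (ea A / ec A) \o (log_dilate (ln ((ec A) ^- 2)) \o
    (log_inv \o log_shift (ed A / ec A))).
  apply/funext => p; rewrite /= -[RHS]of_logK of_log_shift of_log_dilate.
  rewrite of_log_inv of_log_shift lnK; last by rewrite posrE invr_gt0 exprn_even_gt0.
  rewrite /log_mob; congr to_log; have y0 := of_log_gt0 p.
  move: (of_log p) y0 => q y0; have := mob_den_gt0 A y0; rewrite /mob /mob_num.
  have -> : (q.1 + ed A / ec A) ^+ 2 + q.2 ^+ 2 = mob_den A q / ec A ^+ 2.
    by rewrite /mob_den; field.
  move=> N0; have N1 := lt0r_neq0 N0; rewrite /=; congr (_, _); last first.
    by move: (mob_den A q) N1 => N N1; field; rewrite c0 N1.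
  have -> : ec A ^- 2 * (- (q.1 + ed A / ec A) / (mob_den A q / ec A ^+ 2)) + ea A / ec A =
     (ea A * mob_den A q - (ec A * q.1 + ed A)) / ec A / mob_den A q.
    by move: (mob_den A q) N1 => N N1; field; rewrite c0 N1.
  congr (_ / _); apply: (mulIf c0); rewrite divfK //.
  rewrite -[ec A * q.1 + ed A in RHS]mul1r -(SL2_detE A) /mob_den; ring.
apply: preserves_comp; first exact: preserves_shift.
apply: preserves_comp; first exact: preserves_dilate.
by apply: preserves_comp; [exact: preserves_inv|exact: preserves_shift].
Qed.

End Mobius.


(** * Finite area makes the cusp values dense *)

Lemma bounded_overlap d (T : measurableType d) (R : realType)
    (mu : {measure set T -> \bar R}) (V : nat -> set T) (E : set T) (M : nat) :
  measurable E -> (forall n, measurable (V n)) -> (forall n, V n `<=` E) ->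
  (forall p N, \sum_(n < N) (\1_(V n) p : R) <= M%:R) ->
  (\sum_(n <oo) mu (V n) <= M%:R%:E * mu E)%E.
Proof.
move=> mE mV VE VM.
apply: lime_le; first by apply: is_cvg_nneseries => n _ _; exact: measure_ge0.
near=> N.
rewrite big_mkord.
have -> : (\sum_(n < N) mu (V n) = \int[mu]_(x in E) (\sum_(n < N) (\1_(V n) x)%:E))%E.
  rewrite ge0_integral_sum //.
  - by apply: eq_bigr => n _; rewrite integral_indic // setIidl.
  - by move=> n; apply/measurable_EFinP; exact: measurable_indic.
rewrite -integral_cst //; apply: ge0_le_integral => //.
- by move=> x _; apply: sume_ge0 => n _; rewrite lee_fin.
- apply: emeasurable_sum => n; apply/measurable_EFinP; exact: measurable_indic.
- by move=> x _; rewrite sumEFin lee_fin.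
Unshelve. all: by end_near. Qed.

Section Density.
Context {R : realType}.
Local Notation lam := (@lebesgue_measure R).
Local Notation plane := (measurableTypeR R * measurableTypeR R)%type.
Local Notation mu2 := (lam \x lam)%E.
Implicit Types (A B : SL2 R).

Lemma fuchsian_countable (Gam : set (SL2 R)) P : fuchsian Gam P -> countable Gam.
Proof.
move=> fG; have -> : Gam = \bigcup_n (Gam `&` entries_le n%:R).
  apply/seteqP; split => [A GA|A [n _ []]] //.
  pose M := `|ea A| + `|eb A| + `|ec A| + `|ed A|.
  exists (Num.truncn M).+1 => //; split => //.
  have := truncnS_gt M; have := normr_ge0 (ea A); have := normr_ge0 (eb A).
  have := normr_ge0 (ec A); have := normr_ge0 (ed A); rewrite /M /entries_le /=.
  move: (`|ea A|) (`|eb A|) (`|ec A|) (`|ed A|) (_.+1%:R) => a b c d n.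
  by clear => ? ? ? ? ?; split; lra.
apply: bigcup_countable; first exact: countableP.
by move=> n _; apply: finite_set_countable; exact: fuchsian_finite fG _.
Qed.

Lemma of_log_mob A (p : plane) : of_log (log_mob A p) = mob A (of_log p).
Proof. by rewrite /log_mob to_logK //; apply/mob_gt0/of_log_gt0. Qed.

(** In logarithmic coordinates, a thin layer of height about e^-T above the
    interval of radius r around u; its area grows like e^T. *)
Definition log_strip (u r T : R) : set plane :=
  [set p | `|(of_log p).1 - u| < r /\ - T - 1 < p.2 < - T].

Lemma measurable_log_strip u r T : measurable (log_strip u r T).
Proof.
have m1 : measurable_fun setT (fun p : plane => `|(of_log p).1 - u|).
  apply: measurableT_comp => //; apply: measurable_funB; last exact: measurable_cst.
  exact: measurableT_comp measurable_fst (@measurable_of_log R).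
have -> : log_strip u r T = ((fun p : plane => `|(of_log p).1 - u|) @^-1` `]-oo, r[%classic) `&`
    ((fun p : plane => p.2) @^-1` `](- T - 1), (- T)[%classic).
  by apply/seteqP; split => p /=; rewrite !in_itv.
apply: measurableI.
  by rewrite -[X in measurable X]setTI; apply: m1.
by rewrite -[X in measurable X]setTI; apply: measurable_snd.
Qed.

Lemma log_strip_area u r T : 0 < r -> ((r * expR T)%:E <= mu2 (log_strip u r T))%E.
Proof.
move=> r0; rewrite mu2_y; last exact: measurable_log_strip.
have itv1 : lam `](- T - 1), (- T)[ = 1%E.
  rewrite lebesgue_measure_itv /= lte_fin ltrBlDr ltrDl ltr01.
  by rewrite -EFinB; congr (_%:E); ring.
rewrite -[leLHS]mule1 -itv1 -integral_cst //.
rewrite integral_mkcond; apply: ge0_le_integral => //.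
- move=> t _; rewrite patchE; case: ifP => // _; rewrite lee_fin mulr_ge0 ?expR_ge0 ?ltW //.
- by apply/measurable_restrict => //; exact: measurable_cst.
- by apply: measurable_fun_ysection; exact: measurable_log_strip.
move=> t _; rewrite patchE; case: ifPn => [/set_mem /=|_]; last exact: measure_ge0.
rewrite in_itv /= => tT.
have -> : ysection (log_strip u r T) t = (fun s => expR t * s) @^-1` (ball u r).
  apply/seteqP; split => s; rewrite ysectionE /log_strip /ball /= distrC.
    by case.
  by split.
rewrite lebesgue_scale ?expR_gt0 //; last exact: measurable_ball.
rewrite lebesgue_measure_ball ?(ltW r0) // -EFinM /= lee_fin.
rewrite mulr2n mulrDr -[leLHS]addr0; apply: lerD; last first.
  by rewrite mulr_ge0 ?invr_ge0 ?expR_ge0 // ltW.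
rewrite mulrC ler_pM2r // -expRN ler_expR.
by move: tT => /andP[_]; rewrite ltrNr => /ltW.
Qed.

(** If z and A z both lie above the interval of radius r around u, their real
    parts stay at distance r from - d / c = A^-1 . oo and a / c = A . oo.  As
    |A z - a / c| = 1 / (|c| |c z + d|) this bounds c and d; the inverse of A
    gives the bound on a. *)
Lemma return_entries_bounded (Gam : set (SL2 R)) P m u r : fuchsian Gam P ->
  0 < m -> (forall A, Gam A -> ec A != 0 -> m <= `|ec A|) -> 0 < r ->
  (forall A, Gam A -> ec A != 0 -> 2 * r <= `|cuspval A - u|) ->
  exists K, forall A (p : R * R), Gam A -> 0 < p.2 ->
    `|p.1 - u| < r -> `|(mob A p).1 - u| < r -> entries_le K A.
Proof.
move=> fG m0 mP r0 far.
pose K0 := (r * m)^-1 + r^-1 * (`|u| + r).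
have K00 : 0 <= K0.
  by rewrite !(addr_ge0, mulr_ge0, invr_ge0) // ltW.
pose K := 1 + r^-1 + 2 * r + K0 + (K0 * K0 + 1) / m.
have V0 : 0 <= r^-1 by rewrite invr_ge0 ltW.
have Q0 : 0 <= (K0 * K0 + 1) / m by rewrite divr_ge0 ?(ltW m0) // addr_ge0 // mulr_ge0.
have low A (p : R * R) : Gam A -> 0 < p.2 -> ec A != 0 ->
    `|p.1 - u| < r -> `|(mob A p).1 - u| < r -> `|ec A| <= r^-1 /\ `|ed A| <= K0.
  move=> GA y0 c0 pu Apu.
  have nc : 0 < `|ec A| by rewrite normr_gt0.
  have h1 : r * `|ec A| <= `|ec A * p.1 + ed A|.
    have := far _ (fuchV fG GA); rewrite /cuspval eaV ecV oppr_eq0 => /(_ c0) h.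
    have -> : ec A * p.1 + ed A = ec A * (p.1 - ed A / - ec A) by field.
    rewrite normrM mulrC ler_wpM2l //.
    have := ler_distD p.1 (ed A / - ec A) u; rewrite (distrC _ p.1).
    by move: h pu; clear; lra.
  have h2 : `|ec A| * `|ec A * p.1 + ed A| <= r^-1.
    have N0 := mob_den_gt0 A y0.
    have E : (mob A p).1 - cuspval A = - (ec A * p.1 + ed A) / (ec A * mob_den A p).
      apply: (mulIf (mulf_neq0 c0 (lt0r_neq0 N0))); rewrite divfK ?mulf_neq0 ?(gt_eqF N0) //.
      rewrite /cuspval /mob /=.
      have -> : (mob_num A p / mob_den A p - ea A / ec A) * (ec A * mob_den A p) =
          ec A * mob_num A p - ea A * mob_den A p.
        by move: (mob_den A p) (lt0r_neq0 N0) => N N1; field; rewrite c0 N1.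
      rewrite -[RHS]mul1r -(SL2_detE A) /mob_num /mob_den; ring.
    have h3 : r <= `|(mob A p).1 - cuspval A|.
      have := ler_distD (mob A p).1 (cuspval A) u; rewrite (distrC (cuspval A) (mob A p).1).
      by have := far _ GA c0; move: Apu; clear; lra.
    have d0 : 0 < `|ec A * p.1 + ed A|.
      by apply: lt_le_trans h1; exact: mulr_gt0.
    rewrite -(ler_pM2r r0) mulVf ?gt_eqF // [leLHS]mulrC.
    apply: le_trans (ler_wpM2r _ h3) _; first by rewrite mulr_ge0.
    rewrite E !normrM normrN normfV normrM (gtr0_norm N0).
    set w := `|_ + _| in d0 *.
    have w2 : w * w <= mob_den A p.
      by rewrite /w -expr2 real_normK ?num_real // lerDl sqr_ge0.
    have -> : w / (`|ec A| * mob_den A p) * (`|ec A| * w) = w * w / mob_den A p.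
      by move: (mob_den A p) (`|ec A|) N0 nc => N c N0 nc; field; rewrite !gt_eqF.
    by rewrite ler_pdivrMr // mul1r.
  have c1 : `|ec A| <= r^-1.
    have : `|ec A| * (r * `|ec A|) <= r^-1 by apply: le_trans h2; rewrite ler_wpM2l.
    rewrite mulrCA -expr2 => h3; have : `|ec A| ^+ 2 <= r^-1 ^+ 2.
      by rewrite expr2 -ler_pdivrMl ?invr_gt0 // invrK.
    by rewrite ler_sqr ?nnegrE.
  split => //; have h3 : `|ec A * p.1 + ed A| <= (r * m)^-1.
    rewrite invfM -ler_pdivrMr ?invr_gt0 // invrK; apply: le_trans h2.
    by rewrite mulrC ler_wpM2r // mP.
  have pu' : `|p.1| <= `|u| + r.
    by have := ler_distD u p.1 0; rewrite !subr0; move: pu; clear; lra.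
  have -> : ed A = (ec A * p.1 + ed A) - ec A * p.1 by ring.
  apply: le_trans (ler_normB _ _) _; rewrite normrM; apply: lerD => //.
  by apply: ler_pM.
exists K => A p GA y0 pu Apu; have D := SL2_detE A.
have [c0|c0] := eqVneq (ec A) 0.
  have a1 : `|ea A| = 1 by exact: (fuchsian_stabilizer fG).
  have d1 : `|ed A| = 1.
    by rewrite -eaV; apply: (fuchsian_stabilizer fG); rewrite ?ecV ?c0 ?oppr0 //; exact: (fuchV fG).
  have a2 : ea A ^+ 2 = 1 by rewrite -real_normK ?num_real // a1 expr1n.
  have b1 : `|eb A| <= 2 * r.
    have ad : ea A * ed A = 1 by move: D; rewrite c0 mulr0 subr0.
    have E : (mob A p).1 - u - (p.1 - u) = ea A * eb A.
      have dE : ed A = ea A.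
        by rewrite -[RHS]mulr1 -ad mulrA -expr2 a2 mul1r.
      have -> : (mob A p).1 = ea A ^+ 2 * p.1 + ea A * eb A.
        rewrite /mob /mob_num /mob_den c0 dE /= !(mul0r, mulr0, add0r) expr0n /= !addr0 [X in _ / X]a2 divr1.
        by ring.
      by rewrite a2; ring.
    have : `|ea A * eb A| <= `|(mob A p).1 - u| + `|p.1 - u| by rewrite -E; exact: ler_normB.
    by rewrite normrM a1 mul1r; move: pu Apu; clear; lra.
  rewrite /entries_le /= a1 d1 c0 normr0 /K.
  by clear -b1 V0 K00 Q0 r0; split; lra.
have [cK dK] := low A p GA y0 c0 pu Apu.
have [_ aK] : `|ec A^-1%g| <= r^-1 /\ `|ed A^-1%g| <= K0.
  apply: (low _ (mob A p)); rewrite -?mobM ?mulVg ?mob1 ?mob_gt0 //.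
  - exact: (fuchV fG).
  - by rewrite ecV oppr_eq0.
rewrite edV in aK.
have bK : `|eb A| <= (K0 * K0 + 1) / m.
  rewrite ler_pdivlMr //; apply: (@le_trans _ _ (`|eb A| * `|ec A|)).
    by rewrite ler_wpM2l // mP.
  rewrite -normrM; have -> : eb A * ec A = ea A * ed A - 1 by rewrite -D; ring.
  apply: le_trans (ler_normB _ _) _; rewrite normr1 lerD2r normrM.
  by apply: ler_pM.
split; rewrite /K.
- by clear -aK V0 K00 Q0 r0; lra.
- by clear -bK V0 K00 Q0 r0; lra.
- by clear -cK V0 K00 Q0 r0; lra.
- by clear -dK V0 K00 Q0 r0; lra.
Qed.

(** Otherwise the translates of F cover each strip [log_strip] u r T, and no point
    of F has more than [size L] images in it, where L lists the elements of the
    group with entries bounded as in [return_entries_bounded].  Hence the area of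
    the strip is bounded independently of T. *)
Theorem cusps_dense (Gam : set (SL2 R)) P m (F : set plane) : fuchsian Gam P ->
  0 < m -> (forall A, Gam A -> ec A != 0 -> m <= `|ec A|) ->
  measurable F -> (forall p, F p -> 0 < p.2) ->
  (\int[mu2]_(p in F) (p.2 ^- 2)%:E < +oo)%E ->
  (forall p : R * R, 0 < p.2 -> exists2 A, Gam A & F (mob A p)) ->
  forall (u d : R), 0 < d ->
    exists A, [/\ Gam A, ec A != 0 & `|cuspval A - u| < d].
Proof.
move=> fG m0 mP mF F0 Foo cover u d d0; apply: contrapT => none.
pose r := d / 2; have r0 : 0 < r by rewrite divr_gt0.
have far A : Gam A -> ec A != 0 -> 2 * r <= `|cuspval A - u|.
  move=> GA c0; rewrite leNgt; apply/negP => h; apply: none; exists A; split => //.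
  by move: h; rewrite /r mulrC divfK // pnatr_eq0.
have [K retK] := return_entries_bounded fG m0 mP r0 far.
have /finite_seqP[L LE] := fuchsian_finite fG K.
pose E : set plane := @of_log R @^-1` F.
have mE : measurable E.
  by rewrite -[X in measurable X]setTI; exact: measurable_of_log.
have Eoo : (mu2 E < +oo)%E by rewrite area_of_log.
have Efin : mu2 E \is a fin_num by rewrite ge0_fin_numE.
pose T := (size L)%:R * fine (mu2 E) / r.
pose D := log_strip u r T.
have mD : measurable D := measurable_log_strip u r T.
have mpre A (B : set plane) : measurable B -> measurable (log_mob A @^-1` B).
  move=> mB; rewrite -[X in measurable X]setTI.
  by have [mA _] := preserves_log_mob A; exact: mA.
have /countable_injP[f finj] := fuchsian_countable fG.
have [S SP] : exists S : nat -> option (SL2 R),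
    (forall n A, S n = Some A -> Gam A /\ f A = n) /\
    (forall A, Gam A -> S (f A) = Some A).
  pose S n := if pselect (exists A, Gam A /\ f A = n) is left h
              then Some (sval (cid h)) else None.
  have S1 n A : S n = Some A -> Gam A /\ f A = n.
    by rewrite /S; case: pselect => // h [<-]; exact: (svalP (cid h)).
  exists S; split => // A GA.
  case SA: (S (f A)) => [B|]; last first.
    by move: SA; rewrite /S; case: pselect => // -[]; exists A.
  have [GB fB] := S1 _ _ SA; congr Some.
  by apply: finj fB; exact: mem_set.
have [S1 S2] := SP.
(* W covers the strip; V is W moved back into E by the inverse of A. *)
pose W n := if S n is Some A then D `&` log_mob A @^-1` E else set0.
pose V n := if S n is Some A then E `&` log_mob A^-1%g @^-1` D else set0.
have mW n : measurable (W n).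
  by rewrite /W; case: (S n) => [A|] //; apply: measurableI => //; exact: mpre.
have mV n : measurable (V n).
  by rewrite /V; case: (S n) => [A|] //; apply: measurableI => //; exact: mpre.
have WV n : mu2 (W n) = mu2 (V n).
  have := mW n; rewrite /W /V; case: (S n) => [A|] // mWA.
  have [_ pA] := preserves_log_mob A^-1%g.
  rewrite -(pA _ mWA); congr (mu2 _).
  apply/seteqP; split => p /=; rewrite -log_mobM mulgV log_mob1; last by case.
  by case.
have DW : D `<=` \bigcup_n W n.
  move=> p Dp; have [A GA FA] := cover (of_log p) (of_log_gt0 p).
  exists (f A) => //; rewrite /W S2 //; split => //=.
  by rewrite /E /= of_log_mob.
have overlap p N : \sum_(n < N) (\1_(V n) p : R) <= (size L)%:R.
  pose s := [seq n <- iota 0 N | p \in V n].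
  have -> : \sum_(n < N) (\1_(V n) p : R) = (size s)%:R.
    rewrite size_filter -sum1_count natr_sum [RHS]big_mkcond /=.
    rewrite -(big_mkord xpredT (fun n => \1_(V n) p)) /index_iota subn0.
    by apply: eq_bigr => n _; rewrite indicE; case: (_ \in _).
  rewrite ler_nat.
  case sE : s => [|n0 s'] //; rewrite -sE.
  have sP n : n \in s -> exists A, [/\ S n = Some A, Gam A, f A = n & D (log_mob A^-1%g p)].
    rewrite mem_filter => /andP[/set_mem + _]; rewrite /V.
    case SA : (S n) => [A|] // [_ DA]; exists A.
    by have [GA fA] := S1 _ _ SA.
  have [A0 [_ GA0 _ D0]] : exists A, [/\ S n0 = Some A, Gam A, f A = n0 & D (log_mob A^-1%g p)].
    by apply: sP; rewrite sE inE eqxx.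
  pose g n := if S n is Some A then (A^-1 * A0)%g else 1%g.
  rewrite -(size_map g); apply: uniq_leq_size.
    rewrite map_inj_in_uniq; first by rewrite filter_uniq // iota_uniq.
    move=> n n' /sP[A [SA _ fA _]] /sP[A' [SA' _ fA' _]].
    by rewrite /g SA SA' => /mulIg /invg_inj AA'; rewrite -fA -fA' AA'.
  move=> _ /mapP[n /sP[A [SA GA _ DA]] ->]; rewrite /g SA.
  have GAA : Gam (A^-1 * A0)%g by apply: (fuchM fG) => //; exact: (fuchV fG).
  suff : (Gam `&` entries_le K) (A^-1 * A0)%g by rewrite LE.
  split => //; apply: (retK _ (of_log (log_mob A0^-1%g p))) => //.
  - exact: of_log_gt0.
  - by case: D0.
  - have -> : mob (A^-1 * A0)%g (of_log (log_mob A0^-1%g p)) = of_log (log_mob A^-1%g p).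
      by rewrite -of_log_mob -log_mobM mulgK.
    by case: DA.
have muD : (mu2 D <= (size L)%:R%:E * mu2 E)%E.
  have VE n : V n `<=` E by move=> p; rewrite /V; case: (S n) => [A []|].
  apply: le_trans (bounded_overlap _ mE mV VE overlap).
  have subW : (mu2 D <= \sum_(n <oo) mu2 (W n))%E by exact: measure_sigma_subadditive.
  apply: le_trans subW _.
  by rewrite (eq_eseriesr (fun n _ => WV n)).
have := le_trans (log_strip_area u T r0) muD.
rewrite -(fineK Efin) -EFinM lee_fin leNgt => /negP; apply.
have -> : (size L)%:R * fine (mu2 E) = r * T by rewrite /T [RHS]mulrC divfK // gt_eqF.
by rewrite ltr_pM2l //; apply: lt_le_trans (expR_ge1Dx T); rewrite ltrDr.
Qed.

End Density.

(** * From PSL2 to SL2 *)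

Section Lift.
Context {R : realType}.
Implicit Types (A B : SL2 R) (g : PSL2 R) (G : set (PSL2 R)).

Definition lifted G : set (SL2 R) := [set A | G (\pi_(PSL2 R) A)].

Lemma opp_entries A : [/\ ea (SL2_opp A) = - ea A, eb (SL2_opp A) = - eb A,
  ec (SL2_opp A) = - ec A & ed (SL2_opp A) = - ed A].
Proof. by split; rewrite /ea /eb /ec /ed /= mxE. Qed.

Lemma pi_opp A : \pi_(PSL2 R) (SL2_opp A) = \pi_(PSL2 R) A.
Proof. by apply/PSL2_piP; rewrite /eq_up_to_sign eqxx orbT. Qed.

Lemma pi_mul A B : \pi_(PSL2 R) (A * B)%g = (\pi_(PSL2 R) A * \pi_(PSL2 R) B)%g.
Proof. by rewrite -PSL2_mul_pi. Qed.

Lemma pi_inv A : \pi_(PSL2 R) (A^-1)%g = (\pi_(PSL2 R) A)^-1%g.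
Proof. by rewrite -PSL2_inv_pi. Qed.

Lemma lifted_repr G g : G g -> lifted G (repr g).
Proof. by rewrite /lifted /= reprK. Qed.

Lemma nbhs_pi1 (V : set (PSL2 R)) : nbhs (1%g : PSL2 R) V ->
  exists2 eps : R, 0 < eps & forall A, `|ea A - 1| < eps -> `|eb A| < eps ->
    `|ec A| < eps -> `|ed A - 1| < eps -> V (\pi_(PSL2 R) A).
Proof.
(* V contains the image of a set U that is open for the topology induced by the
   one of matrices, hence the image of a ball of matrices. *)
move=> nV; have /(@pi_continuous _ _ (1%g : SL2 R)) : nbhs (\pi_(PSL2 R) 1%g) V by [].
rewrite nbhs_simpl nbhsE; case=> U [[B oB BU] U1] UV.
have nB : nbhs (SL2mx (1%g : SL2 R)) B.
  by apply: open_nbhs_nbhs; split => //; move: U1; rewrite -BU.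
have /nbhs_ballP[e /= e0 eB] := nB.
exists e => // A hA hB hC hD; apply: UV; rewrite -BU /=; apply: eB; split => // i j.
have [a b c d] := @SL2_entries1 R.
have [k1 k2 k3 k4] : [/\ `|ea A - ea 1%g| < e, `|eb A - eb 1%g| < e,
    `|ec A - ec 1%g| < e & `|ed A - ed 1%g| < e] by rewrite a b c d !subr0.
by case: (ord2P i) => ->; case: (ord2P j) => ->; rewrite /ball /= distrC.
Qed.

(** A parabolic element fixing oo has a = d = 1 or a = d = - 1; up to sign and
    inversion it is the translation by some P > 0. *)
Lemma lifted_fuchsian G : discrete_subgroup G -> cusp G None ->
  exists P, fuchsian (lifted G) P.
Proof.
move=> [Ggrp Giso] [g [Gg [g1 trg] gfix]].
have [G1 _] := Ggrp; have {}G1 : G 1%g by apply/set_mem.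
have GM h k : G h -> G k -> G (h * k)%g.
  by move=> /mem_set hG /mem_set kG; apply/set_mem; exact: (group_closedM Ggrp).
have GV h : G h -> G h^-1%g.
  by move=> /mem_set hG; apply/set_mem; exact: (group_closedV Ggrp).
have LM A B : lifted G A -> lifted G B -> lifted G (A * B)%g.
  by rewrite /lifted /= pi_mul; exact: GM.
have LV A : lifted G A -> lifted G A^-1%g by rewrite /lifted /= pi_inv; exact: GV.
have L1 : lifted G 1%g by exact: G1.
have disc : exists2 eps : R, 0 < eps & forall A, lifted G A ->
    `|ea A - 1| < eps -> `|eb A| < eps -> `|ec A| < eps -> `|ed A - 1| < eps ->
    A = 1%g.
  have : isolated G 1%g by rewrite Giso.
  move=> [_ [V nV VG]]; have [e e0 eV] := nbhs_pi1 nV.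
  exists (Num.min e 1); first by rewrite lt_min e0 ltr01.
  move=> A LA; rewrite !lt_min => /andP[hA hA1] /andP[hB _] /andP[hC _] /andP[hD _].
  have : (V `&` G) (\pi_(PSL2 R) A) by split => //; exact: eV.
  rewrite VG => /PSL2_piP /orP[/eqP //|/eqP E].
  move: hA1; rewrite E; have [-> _ _ _] := opp_entries (1%g : SL2 R).
  have [-> _ _ _] := @SL2_entries1 R.
  by rewrite ltr_norml => /andP[h _]; exfalso; move: h; lra.
have [A [LA A1 c0 a1]] : exists A, [/\ lifted G A, A <> 1%g, ec A = 0 & ea A = 1 /\ ed A = 1].
  pose A := repr g; have LA : lifted G A := lifted_repr Gg.
  have gA : \pi_(PSL2 R) A = g by exact: reprK.
  have c0 : ec A = 0.
    by move: gfix; rewrite /bact; case: ifPn => // /eqP.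
  have ad : ea A * ed A = 1 by have := SL2_detE A; rewrite c0 mulr0 subr0.
  have tr : (ea A + ed A) ^+ 2 = 4 := trg.
  have da : ed A = ea A.
    apply/eqP; rewrite -subr_eq0 -sqrf_eq0; apply/eqP.
    have -> : (ed A - ea A) ^+ 2 = (ea A + ed A) ^+ 2 - 4 * (ea A * ed A) by ring.
    by rewrite tr ad; ring.
  have : (ea A) ^+ 2 = 1 by rewrite expr2 -{2}da.
  move=> /eqP; rewrite sqrf_eq1 => /orP[] /eqP a1.
    exists A; split => //; last by rewrite da.
    by move=> A1; apply: g1; rewrite -gA A1.
  have [oa ob oc od] := opp_entries A.
  exists (SL2_opp A); split; rewrite ?oa ?oc ?od ?da ?c0 ?a1 ?oppr0 ?opprK //.
    by rewrite /lifted /= pi_opp.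
  by move=> A1; apply: g1; rewrite -gA -pi_opp A1.
have [a1' d1] := a1.
have b0 : eb A != 0.
  apply/eqP => b0; apply: A1; have [a b c d] := @SL2_entries1 R.
  by apply: SL2_ext; rewrite ?a ?b ?c ?d.
have [bneg|bpos] := ltP (eb A) 0.
  exists (- eb A); split => //; first by rewrite oppr_gt0.
  by exists A^-1%g; [exact: LV|split; rewrite entriesM ?a1' ?d1 ?c0 ?oppr0].
exists (eb A); split => //; first by rewrite lt_def b0.
by exists A.
Qed.

Lemma hact_mob g (z : halfplane R) : hcoord (hact g z) = mob (repr g) (hcoord z).
Proof.
case: z => [[x y] /= y0]; rewrite /hcoord /= /moebius /mob /mob_num /mob_den /=.
rewrite -[ent_a g]/(ea (repr g)) -[ent_b g]/(eb (repr g)) -[ent_c g]/(ec (repr g)) -[ent_d g]/(ed (repr g)).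
have N0 := lt0r_neq0 (mob_den_gt0 (repr g) (p := (x, y)) y0); rewrite /mob_den /= in N0.
have D := SL2_detE (repr g).
move: (ea _) (eb _) (ec _) (ed _) N0 D => a b c d N0 D.
rewrite !(mul0r, add0r, addr0, subr0, mulr0); move: N0.
set N := (_ ^+ 2 + _ ^+ 2) => N0; congr (_, _).
  by field.
apply: (mulIf N0); rewrite divfK //.
have -> : ((a * x + b) * - (c * y / N) + a * y * ((c * x + d) / N)) * N =
  y * (a * d - b * c) by field.
by rewrite D mulr1.
Qed.

Lemma mob_opp A p : mob (SL2_opp A) p = mob A p.
Proof.
have [a b c d] := opp_entries A.
rewrite /mob; have -> : mob_den (SL2_opp A) p = mob_den A p.
  by rewrite /mob_den c d; ring.
by congr (_ / _, _); rewrite /mob_num a b c d; ring.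
Qed.

Lemma hcoord_inj : injective (@hcoord R).
Proof. by move=> [[x y] h] [[x' y'] h'] [xE yE]; apply: val_inj; rewrite /= xE yE. Qed.

Lemma hact1 (z : halfplane R) : hact 1%g z = z.
Proof.
apply: hcoord_inj; rewrite hact_mob.
by case: (repr_PSL2_pi (1%g : SL2 R)) => ->; rewrite ?mob_opp mob1.
Qed.

Lemma fundamental_cover G (F : set (halfplane R)) : discrete_subgroup G ->
  fundamental_set G F -> forall p : R * R, 0 < p.2 ->
  exists2 A, lifted G A & (hcoord @` F) (mob A p).
Proof.
move=> [Ggrp _] [_ [_ _ Fsurj]] p y0.
have [G1 _] := Ggrp; have {}G1 : G 1%g by apply/set_mem.
have zP : 0 < complex.Im (Complex p.1 p.2) by [].
pose z := MkHalfplane zP.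
have [w Fw wz] := Fsurj (\pi_(orbit_space G) z) I.
have so : same_orbit G w z.
  exact/(@eqmodP _ (same_orbit_equiv G) w z).
move: so => /asboolP oE.
have : Defs.orbit G w z by rewrite oE; exists 1%g => //; exact: hact1.
move=> [g Gg gw]; pose A := repr g.
exists A^-1%g.
  by rewrite /lifted /= pi_inv reprK; apply/set_mem; apply: (group_closedV Ggrp); exact: mem_set.
exists w => //.
have -> : p = hcoord z by rewrite /hcoord /z /=; case: (p).
by rewrite -gw hact_mob -mobM ?mulVg ?mob1 //; case: (w).
Qed.

End Lift.

Lemma lattice_dense_fuchsian (R : realType) (G : set (PSL2 R)) :
  nonuniform_lattice G -> cusp G None ->
  exists P m, dense_fuchsian (lifted G) P m.
Proof.
move=> [Gdisc Garea _] Gcusp.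
have [P fG] := lifted_fuchsian Gdisc Gcusp.
have [m m0 mP] := fuchsian_lower_left fG.
have [_ [F FG <-] Foo] := ereal_inf_lt Garea.
exists P, m; split => // u d d0.
have [mF _] := FG.
apply: (cusps_dense fG m0 mP mF _ Foo (fundamental_cover Gdisc FG)) => //.
by move=> _ [z _ <-]; case: z.
Qed.

(** * The Lagrange spectrum *)

Section Spectrum.
Context {R : realType}.
Implicit Types (A : SL2 R) (g : PSL2 R) (G : set (PSL2 R)) (alpha k : R).

Lemma bact_cuspval g : ent_c g != 0 -> bact g None = Some (cuspval (repr g)).
Proof. by move=> /negbTE c0; rewrite /bact c0. Qed.

Lemma cuspgap_lt g alpha k : ent_c g != 0 -> 0 < k ->
  (`|alpha - ent_a g / ent_c g| < 1 / (k * ent_c g ^+ 2)) =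
  (cuspgap (repr g) alpha < k^-1).
Proof.
move=> c0 k0; rewrite cuspgapE // -[ec (repr g)]/(ent_c g) -/(cuspval (repr g)).
have c2 : 0 < ent_c g ^+ 2 by rewrite exprn_even_gt0.
by rewrite -ltr_pdivlMl // mul1r invfM [k^-1 * _]mulrC.
Qed.

Lemma repr_pi_entries A : cuspval (repr (\pi_(PSL2 R) A)) = cuspval A /\
  `|ec (repr (\pi_(PSL2 R) A))| = `|ec A|.
Proof.
case: (repr_PSL2_pi A) => -> //; have [a b c d] := opp_entries A.
by rewrite /cuspval a c normrN invrN mulrNN.
Qed.

Lemma cuspgap_eq A B alpha : ec A != 0 -> ec B != 0 -> cuspval A = cuspval B ->
  `|ec A| = `|ec B| -> cuspgap A alpha = cuspgap B alpha.
Proof.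
move=> a0 b0 qAB cAB; rewrite !cuspgapE // qAB.
by rewrite -[ec A ^+ 2]real_normK ?num_real // cAB real_normK ?num_real.
Qed.

Lemma lagrange_constE G alpha (L : \bar R) : (0 <= L)%E ->
  (forall k, 0 < k -> (k%:E < L)%E -> approximable G alpha k) ->
  (forall k, 0 < k -> approximable G alpha k -> (k%:E <= L)%E) ->
  lagrange_const G alpha = L.
Proof.
move=> L0 below above; rewrite /lagrange_const.
set S := [set _ | _ in _].
have SL : (ereal_sup S <= L)%E.
  by apply: ge_ereal_sup => _ [k [k0 ka] <-]; exact: above.
apply/eqP; rewrite eq_le ge_max L0 SL /= leNgt gt_max.
apply/negP => /andP[zL sL].
have [k [k0 sk kL]] : exists k : R, [/\ 0 < k, (ereal_sup S < k%:E)%E & (k%:E < L)%E].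
  have m0 : (maxe 0 (ereal_sup S) < L)%E by rewrite gt_max zL.
  have mge : (0 <= maxe 0 (ereal_sup S))%E by rewrite le_max lexx.
  have sge : (ereal_sup S <= maxe 0 (ereal_sup S))%E by rewrite le_max lexx orbT.
  have fin : maxe 0%E (ereal_sup S) \is a fin_num.
    by rewrite ge0_fin_numE // (lt_le_trans m0) // leey.
  move: m0 mge sge; rewrite -(fineK fin); move: (fine _) => x.
  case: L {zL sL SL L0 below above} => [l| |] //.
    rewrite lte_fin lee_fin => xl x0 sx; exists ((x + l) / 2).
    rewrite lte_fin; split; [lra| |lra].
    by apply: le_lt_trans sx _; rewrite lte_fin; lra.
  rewrite lee_fin => _ x0 sx; exists (x + 1); rewrite ltry; split => //; first lra.
  by apply: le_lt_trans sx _; rewrite lte_fin; lra.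
move: sk; rewrite ltNge => /negP; apply; apply: ereal_sup_ubound.
by exists k => //; split => //; exact: below.
Qed.

End Spectrum.

Theorem theorem1p4 (R : realType) (G : set (PSL2 R)) :
  nonuniform_lattice G -> cusp G None ->
  exists L0 : R, [set L : \bar R | (L0%:E <= L)%E] `<=` lagrange_spectrum G.
Proof.
move=> Glat Gcusp.
have [P [m dG]] := lattice_dense_fuchsian Glat Gcusp.
have fG := df_fuchsian dG.
have [eta eta0 gaps] := prescribed_gaps dG.
have e0 : 0 < eta^-1 by rewrite invr_gt0.
exists (2 + eta^-1) => L /= L0L.
pose l i : R := if L is r%:E then r else 2 + eta^-1 + i%:R.
have l2 i : 2 + eta^-1 <= l i.
  move: L0L; rewrite /l; case: (L) => [r| |]; first by rewrite lee_fin.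
    by move=> _; rewrite lerDl.
  by move=> _; rewrite lerDl.
have [alpha [S [GS cS gapS far]]] := gaps l (fun i => ltac:(have := l2 i; lra)).
have cS_mono i j : (i < j)%N -> `|ec (S i)| < `|ec (S j)|.
  elim: j => // j IH; rewrite ltnS leq_eqVlt => /orP[/eqP->//|/IH h].
  exact: lt_trans h (cS j).
have cS_inj i j : `|ec (S i)| = `|ec (S j)| -> i = j.
  move=> E; case: (ltngtP i j) => // /cS_mono; rewrite E ltxx //.
have arch x : exists N : nat, x < N%:R :> R.
  by exists (Num.truncn x).+1; exact: truncnS_gt.
have i0 i : 0 < i.+1%:R :> R by rewrite ltr0n.
exists alpha => //; apply: lagrange_constE.
- by apply: le_trans L0L; rewrite lee_fin addr_ge0 // ltW.
- move=> k k0 kL.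
  have [N HN] : exists N, forall i, (N <= i)%N -> cuspgap (S i) alpha < k^-1.
    suff [N HN] : exists N, forall i, (N <= i)%N -> (l i)^-1 + i.+1%:R^-1 < k^-1.
      exists N => i /HN h; have := gapS i; rewrite ler_norml => /andP[_ h2].
      move: h h2; move: (i.+1%:R^-1) (l i)^-1 (cuspgap _ _) k^-1 => v w z t.
      by clear; lra.
    move: kL L0L l2; rewrite /l; clear -k0 e0 arch i0; case: L => [r| |] // kL L0L l2.
      have kr : k < r by rewrite -lte_fin.
      have r0 : 0 < r by rewrite (lt_trans k0).
      have kr' : 0 < k^-1 - r^-1 by rewrite subr_gt0 ltf_pV2.
      have [N HN] := arch ((k^-1 - r^-1)^-1).
      exists N => i Ni; rewrite -ltrBrDl -[ltRHS]invrK ltf_pV2 ?posrE ?invr_gt0 //.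
      by apply: lt_trans HN _; rewrite ltr_nat ltnS.
    have [N HN] := arch (2 * k); exists N => i Ni.
    have iN : 2 * k < i.+1%:R by apply: lt_trans HN _; rewrite ltr_nat ltnS.
    have h1 : (2 + eta^-1 + i%:R)^-1 <= i.+1%:R^-1.
      have p0 : 0 < 2 + eta^-1 + i%:R by rewrite ltr_wpDr ?ler0n // addr_gt0.
      by rewrite lef_pV2 ?posrE // -natr1; move: e0; lra.
    have h2 : i.+1%:R^-1 < k^-1 / 2.
      by rewrite -invfM ltf_pV2 ?posrE ?mulr_gt0 // mulrC.
    apply: le_lt_trans (lerD h1 (lexx _)) _; move: h2.
    by move: (i.+1%:R^-1) (k^-1) => v w; clear; lra.
  have epi i : ent_c (\pi_(PSL2 R) (S i)) != 0.
    rewrite -normr_gt0 -[ent_c _]/(ec (repr _)); have [_ ->] := repr_pi_entries (S i).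
    by rewrite normr_gt0; have [] := GS i.
  have bact_eq i j : bact (\pi_(PSL2 R) (S i)) None = bact (\pi_(PSL2 R) (S j)) None -> i = j.
    rewrite !bact_cuspval // => -[]; have [-> _] := repr_pi_entries (S i).
    have [-> _] := repr_pi_entries (S j) => q; apply: cS_inj.
    have [Gi ci] := GS i; have [Gj cj] := GS j.
    exact: (cuspval_eq fG Gi Gj ci cj q).
  exists [set \pi_(PSL2 R) (S i) | i in [set i | (N <= i)%N]]; split.
  + by move=> _ [i _ <-]; have [] := GS i.
  + move=> fin; apply: infinite_nat.
    have fin2 : finite_set ((fun i => \pi_(PSL2 R) (S (N + i)%N)) @` setT).
      by apply: sub_finite_set fin => _ [i _ <-]; exists (N + i)%N => //=; rewrite leq_addr.
    rewrite -(eq_finite_set (@inj_card_eq _ _ setT (fun i => \pi_(PSL2 R) (S (N + i)%N)) _)) //.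
    by move=> i j _ _ E; apply/(@addnI N)/bact_eq; rewrite E.
  + by move=> _ _ /set_mem[i _ <-] /set_mem[j _ <-] /bact_eq ->.
  + move=> _ [i Ni <-]; split; first exact: epi.
    rewrite cuspgap_lt //; have [q c] := repr_pi_entries (S i).
    rewrite (@cuspgap_eq _ _ (S i)) ?HN //; last by have [] := GS i.
    exact: epi.
- move=> k k0 [T [TG Tinf Tinj Tk]]; rewrite leNgt; apply/negP => Lk.
  have [r [Lr r0 rk]] : exists r, [/\ L = r%:E, 2 + eta^-1 <= r & r < k].
    move: L0L Lk; case: (L) => [r| |] //; rewrite lee_fin lte_fin => ? ?.
    by exists r.
  have rpos : 0 < r by apply: lt_le_trans r0; rewrite addr_gt0.
  have lr i : l i = r by rewrite /l Lr.
  have kr' : 0 < r^-1 - k^-1 by rewrite subr_gt0 ltf_pV2.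
  have [N HN] := arch ((r^-1 - k^-1)^-1).
  apply: Tinf; rewrite -(eq_finite_set (inj_card_eq Tinj)).
  apply: (@sub_finite_set _ _ ((fun i => Some (cuspval (S i))) @` `I_N)); last first.
    by apply: finite_image; exact: finite_II.
  move=> _ [g Tg <-]; have [c0] := Tk g Tg; rewrite cuspgap_lt // => gk.
  have LA : lifted G (repr g) by apply: lifted_repr; exact: TG.
  have [[i qi]|] := far (repr g) LA c0; last first.
    move=> h; have : eta < k^-1 := le_lt_trans h gk.
    rewrite -[eta]invrK ltf_pV2 ?posrE // => ke.
    by move: r0 rk ke; lra.
  exists i; last by rewrite bact_cuspval // qi.
  rewrite /= ltnNge; apply/negP => Ni; have [Gi ci] := GS i.
  have cE := cuspval_eq fG LA Gi c0 ci qi.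
  have := gapS i; rewrite -(cuspgap_eq alpha c0 ci qi cE) lr ler_norml => /andP[h _].
  have : i.+1%:R^-1 < r^-1 - k^-1.
    rewrite -[ltRHS]invrK ltf_pV2 ?posrE ?invr_gt0 //.
    by apply: lt_trans HN _; rewrite ltr_nat ltnS.
  move: h gk; move: (i.+1%:R^-1) (r^-1) (cuspgap _ _) (k^-1) => v w z t.
  by clear; lra.
Qed.
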